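(* Let $r \ge 1$ be the target rank, with $r \le m$ and $\lambda_{r+1} \neq 0$, let $p \ge 2$ be an integer (the oversampling parameter), and let $\ell = r+p$. Let $\Omega \in \mathbb{R}^{n\times \ell}$ be a standard Gaussian random matrix, let $Y = A\Omega$, let $Y = QR$ be a thin QR factorization, and let $\widehat{H} = A^\top Q Q^\top A$ be the randomized SVD (RandSVD) approximation of $H = A^\top A$. Define $$\Psi_{H}(r,p) = \lambda_{r+1} + \frac{r}{p-1}\sum_{j>r}\lambda_j = \left(1 + \frac{r}{p-1}\,\mathrm{id}_r\right)\lambda_{r+1}, \qquad \mathrm{id}_r = \frac{\sum_{j>r}\lambda_j}{\lambda_{r+1}}.$$ Then the following bounds hold. 1. The error in the SketchSolv solution $\delta\widehat{x}$ satisfies $$\mathbb{E}\left[\frac{\|\delta x - \delta\widehat{x}\|_{\Gamma^{-1}}}{\|\delta x\|_{\Gamma^{-1}}}\right] \le \Psi_{H}(r,p).$$ 2. The condition number of the preconditioned operator satisfies $$\mathbb{E}\left[\kappa_2\left((I+\widehat{H})^{-1/2}(I+H)(I+\widehat{H})^{-1/2}\right)\right] \le 1 + \Psi_{H}(r,p).$$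
   Context: Setting: $m \le n$; $A \in \mathbb{R}^{m\times n}$ is a fixed (deterministic) matrix with singular values $\sigma_1 \ge \dots \ge \sigma_m \ge 0$; $H = A^\top A \in \mathbb{R}^{n\times n}$ has eigenvalues $\lambda_j = \sigma_j^2$ for $1\le j\le m$ and $\lambda_j = 0$ for $m<j\le n$. (In the data assimilation application, $A$ is the matrix obtained by stacking the blocks $R_i^{-1/2} O_i M_i \Gamma^{1/2}$, where $M_i$, $O_i$ are the linearized model and observation operators and $R_i$ the observation error covariances, $i=1,\dots,n_t$.) $\Gamma \in \mathbb{R}^{n\times n}$ is symmetric positive definite (the prior covariance) and $g\in\mathbb{R}^n$ is a fixed nonzero vector (the gradient). Gauss-Newton Hessian: $\mathcal{H} = \Gamma^{-1/2}(I+H)\Gamma^{-1/2}$, and the exact step $\delta x$ is the solution of $\mathcal{H}\,\delta x = -g$. Given a symmetric positive semidefinite approximation $\widehat{H}$ of $H$, set $\widehat{\mathcal{H}} = \Gamma^{-1/2}(I+\widehat{H})\Gamma^{-1/2}$; the SketchSolv solution $\delta\widehat{x}$ is the solution of $\widehat{\mathcal{H}}\,\delta\widehat{x} = -g$, i.e. $\delta\widehat{x} = -\Gamma^{1/2}(I+\widehat{H})^{-1}\Gamma^{1/2} g$. Notation: $\|x\|_{M} = \|M^{1/2}x\|_2$ for symmetric positive definite $M$; $\kappa_2(M) = \|M\|_2\|M^{-1}\|_2$ for invertible $M$, with $\|\cdot\|_2$ the spectral norm. A standard Gaussian random matrix has i.i.d. $N(0,1)$ entries. In a thin QR factorization $Y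 = QR$, the matrix $Q$ has orthonormal columns and $\mathrm{range}(Y)\subseteq \mathrm{range}(Q)$, and $Q$ is determined by $Y$. Expectation is over $\Omega$; exact arithmetic is assumed. *)

(* Defs.v *)
From HB Require Import structures.
From mathcomp Require Export all_boot all_order all_algebra.
From mathcomp Require Export all_classical all_reals all_analysis.
Set Implicit Arguments. Unset Strict Implicit. Unset Printing Implicit Defensive.
Import Order.TTheory GRing.Theory Num.Theory numFieldNormedType.Exports.
Local Open Scope classical_set_scope.
Local Open Scope ring_scope.

(* The Euclidean norm; the library norm [`|x|] on matrices is the max norm. *)
Definition norm2 (R : realType) (n : nat) (x : 'cV[R]_n) : R :=
  Num.sqrt (\sum_(i < n) x i ord0 ^+ 2).

Definition specnorm (R : realType) (m n : nat) (M : 'M[R]_(m, n)) : R :=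
  sup [set norm2 (M *m x) | x in [set x : 'cV[R]_n | norm2 x <= 1]].

Definition cond2 (R : realType) (n : nat) (M : 'M[R]_n) : R :=
  specnorm M * specnorm (invmx M).

Definition sym_psd (R : realType) (n : nat) (M : 'M[R]_n) : Prop :=
  M^T = M /\ forall x : 'cV[R]_n, 0 <= (x^T *m M *m x) ord0 ord0.

Definition sym_pd (R : realType) (n : nat) (M : 'M[R]_n) : Prop :=
  M^T = M /\ forall x : 'cV[R]_n, x != 0 -> 0 < (x^T *m M *m x) ord0 ord0.

(* M^{1/2}: the symmetric positive semidefinite square root, which exists and
   is unique when M is symmetric positive semidefinite (0 is a junk value). *)
Definition sqrtmx (R : realType) (n : nat) (M : 'M[R]_n) : 'M[R]_n :=
  xget 0 [set S | sym_psd S /\ S *m S = M].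

Definition wnorm (R : realType) (n : nat) (M : 'M[R]_n) (x : 'cV[R]_n) : R :=
  norm2 (sqrtmx M *m x).

(* sigma i is the (i+1)-st largest singular value, counted with multiplicity:
   these are the diagonal entries of a singular value decomposition.
   Meaningful for m <= n, so that there are m of them. *)
Definition singular_values (R : realType) (m n : nat) (A : 'M[R]_(m, n))
    (sigma : 'I_m -> R) : Prop :=
  [/\ forall i, 0 <= sigma i,
      forall i j : 'I_m, (i <= j)%N -> sigma j <= sigma i
    & exists (U : 'M[R]_m) (V : 'M[R]_n),
        [/\ U^T *m U = 1%:M, V^T *m V = 1%:M &
            A = U *m (\matrix_(i < m, j < n) (sigma i *+ (i == j :> nat)))
                  *m V^T] ].

(* lam sigma k is the (k+1)-st eigenvalue of A^T A, so that the mathematical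
   lambda_{r+1} is [lam sigma r]; it is 0 beyond the first m indices. *)
Definition lam (R : realType) (m : nat) (sigma : 'I_m -> R) (k : nat) : R :=
  if insub k is Some i then sigma i ^+ 2 else 0.

(* sum_{j > r} lambda_j, with j ranging over the 1-based indices r+1, ..., n. *)
Definition tail_sum (R : realType) (m : nat) (sigma : 'I_m -> R) (n r : nat) : R :=
  \sum_(r <= k < n) lam sigma k.

Definition intdim (R : realType) (m : nat) (sigma : 'I_m -> R) (n r : nat) : R :=
  tail_sum sigma n r / lam sigma r.

Definition Psi (R : realType) (m : nat) (sigma : 'I_m -> R) (n r p : nat) : R :=
  lam sigma r + r%:R / (p%:R - 1) * tail_sum sigma n r.

(* Thin QR: Q has min(m, l) columns, so that l > m is allowed.  When Y is rank
   deficient, Q need not be unique. *)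
Definition thin_qr (R : realType) (m l : nat) (Y : 'M[R]_(m, l))
    (Q : 'M[R]_(m, minn m l)) (S : 'M[R]_(minn m l, l)) : Prop :=
  [/\ Q^T *m Q = 1%:M,
      forall (i : 'I_(minn m l)) (j : 'I_l), (j < i)%N -> S i j = 0
    & Y = Q *m S].

Definition mutually_independent d (T : measurableType d) (R : realType)
    (P : probability T R) (I : finType) (X : I -> {RV P >-> R}) : Prop :=
  forall (J : {set I}) (B : I -> set R), (forall i, measurable (B i)) ->
    P (\bigcap_(i in [set` J]) (X i @^-1` B i)) =
    (\prod_(i in J) P (X i @^-1` B i))%E.

Definition std_gaussian_entries d (T : measurableType d) (R : realType)
    (P : probability T R) (n l : nat)
    (X : 'I_n -> 'I_l -> {RV P >-> R}) : Prop :=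
  (forall i j (B : set R), measurable B ->
     distribution P (X i j) B = normal_prob 0 1 B) /\
  mutually_independent (fun ij : 'I_n * 'I_l => X ij.1 ij.2).

Definition random_mx d (T : measurableType d) (R : realType)
    (P : probability T R) (n l : nat)
    (X : 'I_n -> 'I_l -> {RV P >-> R}) (w : T) : 'M[R]_(n, l) :=
  \matrix_(i, j) X i j w.

Definition gn_hessian (R : realType) (n : nat) (Gamma H : 'M[R]_n) : 'M[R]_n :=
  invmx (sqrtmx Gamma) *m (1%:M + H) *m invmx (sqrtmx Gamma).

Definition rand_svd (R : realType) (m n k : nat) (A : 'M[R]_(m, n))
    (Q : 'M[R]_(m, k)) : 'M[R]_n :=
  A^T *m Q *m Q^T *m A.

Definition precond (R : realType) (n : nat) (H Hhat : 'M[R]_n) : 'M[R]_n :=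
  invmx (sqrtmx (1%:M + Hhat)) *m (1%:M + H) *m invmx (sqrtmx (1%:M + Hhat)).

(* Main.v *)
(* Write A = U Sigma V^T, let V1 be the first r columns of V, B = A (I - V1 V1^T),
   and put D = (I - Q Q^T) A, so that H - Hhat = D^T D.  By Cauchy-Schwarz both
   random quantities are controlled pointwise by any c with |D x|^2 <= c |x|^2.
   Since range (A Omega) is contained in range Q, |D x| <= |(A - A Omega Z) x| for
   every Z.  Take Z = K V1^T, where G = V1^T Omega, S = (G G^T + e I)^{-1} and
   K = G^T S is a regularized right inverse of G; this gives
     c = lambda_{r+1} + e^2 ||A V1 S||_F^2 + ||B Omega K||_F^2.
   The expectation of c is bounded by Gaussian integration by parts
   E <Omega, Phi(Omega)> = E (div Phi)(Omega) alone: the field Phi = V1 K^T yields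
   (p - 1) E tr S <= r, and Phi = B^T B Omega K K^T yields
   E ||B Omega K||_F^2 = ||B||_F^2 E ||K||_F^2 <= ||B||_F^2 E tr S.  Finally e -> 0.
   The regularization makes all fields smooth with bounded K, S and K G, so neither
   the law of G nor its almost sure full rank is needed. *)
From mathcomp Require Import complex sesquilinear spectral ring lra measurable_realfun.
Require Import Defs.
Set Implicit Arguments. Unset Strict Implicit. Unset Printing Implicit Defensive.
Import Order.TTheory GRing.Theory Num.Theory numFieldNormedType.Exports.
Local Open Scope ring_scope.

(** * Square roots of positive definite matrices *)

(** The constant p - 1 is l - r - 1 with l = r + p. The divergence of V1 K^T is tr S (l - tr P) -
    |K|_F^2 with P = K G; here tr P <= r leaves p, and |K|_F^2 <= tr S takes away one more unit. The
    regularization costs only O(e) in expectation: e |S|_F^2 <= tr S bounds e^2 |A V1 S|_F^2 by e |A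
    V1|_F^2 tr S, and the bound on E tr S is uniform in e. Since Q is an arbitrary function of Y,
    the two random quantities may fail to be measurable. All estimates are therefore inequalities
    valid for every realization, against a dominating c that is an integrable function of Omega. The
    mean-zero combinations supplied by integration by parts are built into c itself, so that its
    integral is computed exactly instead of being estimated term by term. *)

Lemma poly_interpolation (F : fieldType) (s : seq F) (f : F -> F) :
  exists q : {poly F}, forall x, x \in s -> q.[x] = f x.
Proof.
elim: s => [|a s [q hq]]; first by exists 0.
have [a_s|a_s] := boolP (a \in s).
  by exists q => x; rewrite inE => /predU1P[->|]; exact: hq.
pose w : {poly F} := \prod_(b <- s) ('X - b%:P).
have wE x : w.[x] = 0 <-> x \in s.
  by rewrite -root_prod_XsubC; split=> /rootP.
exists (q + ((f a - q.[a]) / w.[a]) *: w) => x; rewrite inE !hornerE.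
have wa0 : w.[a] != 0 by apply: contra a_s => /eqP /wE.
case/predU1P=> [->|xs]; first by rewrite divfK// addrC subrK.
by rewrite (proj2 (wE x) xs) mulr0 addr0 hq.
Qed.

Lemma trmx_horner (F : comNzRingType) n (M : 'M[F]_n.+1) (q : {poly F}) :
  M^T = M -> (horner_mx M q)^T = horner_mx M q.
Proof.
move=> sM; elim/poly_ind: q => [|q c ih]; first by rewrite rmorph0 trmx0.
rewrite rmorphD rmorphM /= horner_mx_X horner_mx_C linearD /= tr_scalar_mx.
have -> : (horner_mx M q * M)^T = M * horner_mx M q by rewrite trmx_mul sM ih.
by congr (_ + _); exact/esym/(comm_horner_mx _ (comm_mx_refl M)).
Qed.

Lemma horner_mx_diagonalized (F : fieldType) n (Q : 'M[F]_n.+1) (a : 'rV[F]_n.+1) q :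
  Q \in unitmx -> horner_mx (invmx Q *m diag_mx a *m Q) q =
                  invmx Q *m diag_mx (map_mx (horner q) a) *m Q.
Proof.
move=> uQ; rewrite -[X in _ *m X](invmxK Q) horner_mx_uconj ?unitmx_inv// invmxK.
by rewrite horner_mx_diag.
Qed.

Lemma mulmx_diagonalized (F : fieldType) n (Q : 'M[F]_n) (a b : 'rV[F]_n) :
  Q \in unitmx -> (invmx Q *m diag_mx a *m Q) *m (invmx Q *m diag_mx b *m Q) =
                  invmx Q *m diag_mx (\row_i (a 0 i * b 0 i)) *m Q.
Proof. by move=> uQ; rewrite !mulmxA mulmxK// -(mulmxA (invmx Q)) mulmx_diag. Qed.

(** The eigenbasis lives over the extension C while q has coefficients in F: the identity is checked
    on the diagonal over C and descends because [map_mx f] is injective. *)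
Lemma horner_mx_fourth_power (F C : fieldType) (f : {rmorphism F -> C}) n
    (M : 'M[F]_n.+1) (Q : 'M[C]_n.+1) (a : 'rV[F]_n.+1) (q : {poly F}) :
  Q \in unitmx -> map_mx f M = invmx Q *m diag_mx (map_mx f a) *m Q ->
  (forall i, q.[a 0 i] ^+ 4 = a 0 i) ->
  let N := horner_mx M q in N *m N *m (N *m N) = M.
Proof.
move=> Qu ME qa N; apply: (map_mx_inj (f := f)).
rewrite !map_mxM map_horner_mx ME horner_mx_diagonalized// !mulmx_diagonalized//.
congr (_ *m diag_mx _ *m _); apply/rowP => i; rewrite !mxE horner_map /=.
by rewrite -!rmorphM /= -!expr2 -exprM qa.
Qed.

(** The complexification of M is Hermitian, so the spectral theorem applies; only the basis is
    complex, the eigenvalues being real. *)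
Lemma sym_diagonalizable (R : realType) n (M : 'M[R]_n) : M^T = M ->
  exists (Q : 'M[R[i]%type]_n) (rho : 'rV[R]_n), Q \in unitmx /\
    map_mx (real_complex R) M = invmx Q *m diag_mx (map_mx (real_complex R) rho) *m Q.
Proof.
move=> sM; set A := map_mx _ M.
have A_herm : A \is hermsymmx.
  apply/is_hermitianmxP; rewrite expr0 scale1r; apply/matrixP => i j.
  rewrite !mxE; have := congr1 (fun N : 'M[R]_n => N i j) sM; rewrite mxE => ->.
  by apply/esym/conj_Creal; rewrite complex_real.
have /hermitian_normalmx/orthomx_spectralP AE := A_herm.
exists (spectralmx A), (\row_i complex.Re (spectral_diag A 0 i)).
split; first exact: spectral_unit.
suff <- : spectral_diag A = map_mx (real_complex R) (\row_i complex.Re (spectral_diag A 0 i)).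
  exact: AE.
apply/rowP => i; rewrite !mxE.
by have /mxOverP/(_ 0 i)/RRe_real -> := hermitian_spectral_diag_real A_herm.
Qed.

(* The square root is a polynomial in M: interpolate the fourth root on the
   (real, positive) spectrum and square the resulting symmetric matrix. *)
Lemma sym_pd_sqrt_ex (R : realType) n (M : 'M[R]_n) :
  sym_pd M -> exists S, sym_psd S /\ S *m S = M.
Proof.
case: n M => [|n] M [sM pM].
  exists M; split; last by apply/matrixP => -[].
  by split=> // x; rewrite mxE big_ord0.
have [Q [rho [Qu AE]]] := sym_diagonalizable sM.
(* An eigenvalue of the complexified matrix that comes from R is an eigenvalue of M itself, so a
   real eigenvector is available to test positivity. *)
have rho_gt0 i : 0 < rho 0 i.
  have : eigenvalue (map_mx (real_complex R) M) (real_complex R (rho 0 i)).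
    apply/eigenvalueP; exists (row i Q).
      rewrite AE !mulmxA -row_mul mulmxV// -[row i 1%:M *m _]row_mul mul1mx.
      by rewrite row_diag_mx -scalemxAl -rowE mxE.
    apply/eqP => /(congr1 (fun v => v *m invmx Q)); rewrite mul0mx -row_mul mulmxV//.
    by move/rowP/(_ i); rewrite !mxE eqxx => /eqP; rewrite oner_eq0.
  rewrite eigenvalue_map => /eigenvalueP[v vM v0].
  have vT0 : v^T != 0 by rewrite trmx_eq0.
  have := pM v^T vT0; rewrite trmxK vM -scalemxAl mxE.
  have : 0 <= (v *m v^T) 0 0.
    by rewrite mxE sumr_ge0// => k _; rewrite mxE -expr2 sqr_ge0.
  by rewrite le0r => /predU1P[->|/pmulr_lgt0->//]; rewrite mulr0 ltxx.
have [q hq] := poly_interpolation [seq rho 0 i | i <- enum 'I_n.+1]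
                 (fun x => Num.sqrt (Num.sqrt x)).
have qE i : q.[rho 0 i] = Num.sqrt (Num.sqrt (rho 0 i)).
  by rewrite hq//; apply/mapP; exists i; rewrite ?mem_enum.
pose T := horner_mx M q.
have Tsym : T^T = T by exact: trmx_horner.
have T4 : T *m T *m (T *m T) = M.
  apply: (horner_mx_fourth_power Qu AE) => i; rewrite qE.
  by rewrite (exprM _ 2 2) !sqr_sqrtr ?sqrtr_ge0 ?ltW.
(* As T is symmetric, the quadratic form of T T is |T x|^2, whatever the signs of the eigenvalues of
   T. *)
exists (T *m T); split=> //; split; first by rewrite trmx_mul Tsym.
move=> x; rewrite mulmxA -mulmxA -{1}Tsym -trmx_mul mxE sumr_ge0// => i _.
by rewrite mxE -expr2 sqr_ge0.
Qed.

(** * Frobenius inner product and perturbation bounds *)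

Section FrobeniusInnerProduct.
Variable R : realType.
Implicit Types m n p q : nat.

Definition mxdot m n (M N : 'M[R]_(m, n)) : R := \tr (M^T *m N).

Definition fro2 m n (M : 'M[R]_(m, n)) : R := mxdot M M.

Lemma mxdotE m n (M N : 'M[R]_(m, n)) : mxdot M N = \sum_i \sum_j M i j * N i j.
Proof.
rewrite /mxdot /mxtrace exchange_big; apply: eq_bigr => j _ /=.
by rewrite mxE; apply: eq_bigr => i _; rewrite mxE.
Qed.

Lemma mxdotC m n (M N : 'M[R]_(m, n)) : mxdot M N = mxdot N M.
Proof. by rewrite /mxdot -mxtrace_tr trmx_mul trmxK. Qed.

Lemma mxdotDr m n (M N P : 'M[R]_(m, n)) : mxdot M (N + P) = mxdot M N + mxdot M P.
Proof. by rewrite /mxdot mulmxDr mxtraceD. Qed.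

Lemma mxdotDl m n (M N P : 'M[R]_(m, n)) : mxdot (M + N) P = mxdot M P + mxdot N P.
Proof. by rewrite mxdotC mxdotDr !(mxdotC P). Qed.

Lemma mxdotZr m n a (M N : 'M[R]_(m, n)) : mxdot M (a *: N) = a * mxdot M N.
Proof. by rewrite /mxdot -scalemxAr mxtraceZ. Qed.

Lemma mxdotZl m n a (M N : 'M[R]_(m, n)) : mxdot (a *: M) N = a * mxdot M N.
Proof. by rewrite mxdotC mxdotZr mxdotC. Qed.

Lemma mxdotNr m n (M N : 'M[R]_(m, n)) : mxdot M (- N) = - mxdot M N.
Proof. by rewrite -scaleN1r mxdotZr mulN1r. Qed.

Lemma mxdotNl m n (M N : 'M[R]_(m, n)) : mxdot (- M) N = - mxdot M N.
Proof. by rewrite mxdotC mxdotNr mxdotC. Qed.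

Lemma mxdot_mull m n p (A : 'M[R]_(m, n)) (M : 'M[R]_(n, p)) (N : 'M[R]_(m, p)) :
  mxdot (A *m M) N = mxdot M (A^T *m N).
Proof. by rewrite /mxdot trmx_mul mulmxA. Qed.

Lemma mxdot_mulr m n p (A : 'M[R]_(n, p)) (M : 'M[R]_(m, n)) (N : 'M[R]_(m, p)) :
  mxdot (M *m A) N = mxdot M (N *m A^T).
Proof. by rewrite /mxdot trmx_mul -mulmxA mxtrace_mulC mulmxA. Qed.

Lemma mxdot_trmx m n (M N : 'M[R]_(m, n)) : mxdot M^T N^T = mxdot M N.
Proof. by rewrite /mxdot trmxK mxtrace_mulC -mxtrace_tr trmx_mul trmxK. Qed.

Lemma fro2_ge0 m n (M : 'M[R]_(m, n)) : 0 <= fro2 M.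
Proof.
by rewrite /fro2 mxdotE; do 2 (apply: sumr_ge0 => ? _); rewrite -expr2 sqr_ge0.
Qed.

Lemma fro2_eq0 m n (M : 'M[R]_(m, n)) : (fro2 M == 0) = (M == 0).
Proof.
apply/eqP/eqP => [|->]; last by rewrite /fro2 /mxdot mulmx0 mxtrace0.
rewrite /fro2 mxdotE => /eqP; rewrite psumr_eq0 => [/allP M0|i _]; last first.
  by apply: sumr_ge0 => ? _; rewrite -expr2 sqr_ge0.
apply/matrixP => i j; have := M0 i (mem_index_enum _); rewrite psumr_eq0 /=.
  by move/allP/(_ j (mem_index_enum _)); rewrite /= -expr2 sqrf_eq0 mxE => /eqP.
by move=> ? _; rewrite -expr2 sqr_ge0.
Qed.

Lemma mxdot_CS m n (M N : 'M[R]_(m, n)) : mxdot M N ^+ 2 <= fro2 M * fro2 N.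
Proof.
have [N0|N0] := eqVneq (fro2 N) 0.
  have /eqP -> : N == 0 by rewrite -fro2_eq0 N0.
  by rewrite /mxdot mulmx0 mxtrace0 expr0n mulr_ge0 ?fro2_ge0.
have Np : 0 < fro2 N by rewrite lt_neqAle eq_sym N0 fro2_ge0.
have := fro2_ge0 (fro2 N *: M - mxdot M N *: N).
rewrite /fro2 !(mxdotDr, mxdotDl, mxdotNr, mxdotNl, mxdotZr, mxdotZl) -!/(fro2 _).
rewrite (mxdotC N M) => h; rewrite -(ler_pM2l Np).
by rewrite -subr_ge0; apply: le_trans h _; rewrite le_eqVlt; apply/orP; left; apply/eqP; ring.
Qed.

Lemma fro2D_orth m n (M N : 'M[R]_(m, n)) : mxdot M N = 0 -> fro2 (M + N) = fro2 M + fro2 N.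
Proof. by move=> h; rewrite /fro2 !(mxdotDr, mxdotDl) (mxdotC N M) h addr0 add0r. Qed.

Lemma fro2Z m n a (M : 'M[R]_(m, n)) : fro2 (a *: M) = a ^+ 2 * fro2 M.
Proof. by rewrite /fro2 mxdotZl mxdotZr mulrA expr2. Qed.

Lemma fro2N m n (M : 'M[R]_(m, n)) : fro2 (- M) = fro2 M.
Proof. by rewrite /fro2 mxdotNl mxdotNr opprK. Qed.

Lemma fro2_cols m n (M : 'M[R]_(m, n)) : fro2 M = \sum_j fro2 (col j M).
Proof.
rewrite /fro2 mxdotE exchange_big; apply: eq_bigr => j _; rewrite mxdotE.
by apply: eq_bigr => i _; rewrite big_ord1 !mxE.
Qed.

Lemma fro2_mul_le m n p (M : 'M[R]_(m, n)) (N : 'M[R]_(n, p)) :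
  fro2 (M *m N) <= fro2 M * fro2 N.
Proof.
rewrite (fro2_cols (M *m N)) (fro2_cols N) mulr_sumr; apply: ler_sum => j _.
rewrite colE -mulmxA -colE; move: (col j N) => x.
rewrite /fro2 [leLHS]mxdotE [mxdot M M]mxdotE mulr_suml; apply: ler_sum => i _.
rewrite big_ord1 -expr2.
have -> : (M *m x) i 0 = mxdot (row i M)^T x.
  by rewrite /mxdot trmxK trace_mx11 -row_mul [RHS]mxE.
apply: le_trans (mxdot_CS _ _) _; rewrite /fro2 mxdot_trmx [mxdot (row i M) _]mxdotE big_ord1.
by under eq_bigr do rewrite mxE.
Qed.

Lemma norm2_sqr n (x : 'cV[R]_n) : norm2 x ^+ 2 = fro2 x.
Proof.
rewrite /norm2 sqr_sqrtr; last by apply: sumr_ge0 => i _; exact: sqr_ge0.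
by rewrite /fro2 mxdotE; apply: eq_bigr => i _; rewrite big_ord1 expr2.
Qed.

Lemma norm2_ge0 n (x : 'cV[R]_n) : 0 <= norm2 x.
Proof. exact: sqrtr_ge0. Qed.

Lemma quad_mxdot n (M : 'M[R]_n) (x : 'cV[R]_n) :
  (x^T *m M *m x) ord0 ord0 = mxdot x (M *m x).
Proof. by rewrite /mxdot mulmxA trace_mx11. Qed.

End FrobeniusInnerProduct.

(** * Square-root norms and spectral norm bounds *)

Section Sketch.
Variable R : realType.

Lemma sqrtmxP n (M : 'M[R]_n) :
  sym_pd M -> (sqrtmx M)^T = sqrtmx M /\ sqrtmx M *m sqrtmx M = M.
Proof.
move=> /sym_pd_sqrt_ex h; rewrite /sqrtmx.
by case: (xgetPex 0 h) => -[].
Qed.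

Lemma sym_pd_unit n (M : 'M[R]_n) : sym_pd M -> M \in unitmx.
Proof.
move=> [sM pM]; rewrite -row_free_unit -kermx_eq0; apply/eqP/row_matrixP => i.
rewrite row0; set v := row i _; apply/eqP; rewrite -[_ == 0]negbK; apply/negP => v0.
have vM : v *m M = 0 by rewrite -row_mul mulmx_ker row0.
by have := pM v^T; rewrite trmx_eq0 trmxK vM mul0mx mxE ltxx => /(_ v0).
Qed.

Lemma sqrtmx_unit n (M : 'M[R]_n) : sym_pd M -> sqrtmx M \in unitmx.
Proof.
move=> pM; have := sym_pd_unit pM; have [_ {1}<-] := sqrtmxP pM.
by rewrite unitmx_mul => /andP[].
Qed.

Lemma sym_pd_inv n (M : 'M[R]_n) : sym_pd M -> sym_pd (invmx M).
Proof.
move=> pM; have Mu := sym_pd_unit pM; case: pM => sM pM.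
split=> [|x x0]; first by rewrite trmx_inv sM.
have := pM (invmx M *m x); rewrite trmx_mul trmx_inv sM !mulmxA mulmxKV//; apply.
by apply: contra x0 => /eqP/(congr1 (mulmx M)); rewrite mulKVmx// mulmx0 => ->.
Qed.

(* Only [M^{1/2} M^{1/2} = M] matters for the norm, so no uniqueness of the
   square root is needed to identify [||x||_{M^{-1}}] with [||M^{-1/2} x||]. *)
Lemma wnorm_invE n (M : 'M[R]_n) (x : 'cV[R]_n) :
  sym_pd M -> wnorm (invmx M) x = norm2 (invmx (sqrtmx M) *m x).
Proof.
move=> pM; apply/eqP; rewrite -(@eqrXn2 _ 2)// ?norm2_ge0// !norm2_sqr.
have [s1 e1] := sqrtmxP (sym_pd_inv pM); have [s2 e2] := sqrtmxP pM.
have u2 := sqrtmx_unit pM.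
rewrite /fro2 !mxdot_mull s1 trmx_inv s2 !mulmxA e1.
have -> : invmx M = invmx (sqrtmx M) *m invmx (sqrtmx M).
  rewrite -[RHS](mulKmx (sym_pd_unit pM)) -[X in _ *m (X *m _)]e2.
  by rewrite -(mulmxA (sqrtmx M)) mulKVmx// mulmxV// mulmx1.
by [].
Qed.

(** The hypothesis bounds the set of norms, so [sup] is a true supremum; the set contains 0, which
    gives the lower bound. *)
Lemma specnorm_le m n (M : 'M[R]_(m, n)) (c : R) :
  0 <= c -> (forall x : 'cV[R]_n, fro2 (M *m x) <= c ^+ 2 * fro2 x) ->
  0 <= specnorm M <= c.
Proof.
move=> c0 hM; rewrite /specnorm; set S := (X in sup X).
have S0 : S 0.
  exists 0; last by rewrite mulmx0 /norm2 big1 ?sqrtr0// => i _; rewrite mxE expr0n.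
  by rewrite /= /norm2 big1 ?sqrtr0// => i _; rewrite mxE expr0n.
have ubS : ubound S c.
  move=> _ [x /= x1 <-]; rewrite -(@ler_pXn2r _ 2) ?nnegrE ?norm2_ge0// norm2_sqr.
  apply: le_trans (hM x) _; rewrite -norm2_sqr ler_piMr ?sqr_ge0//.
  by rewrite expr_le1// norm2_ge0.
apply/andP; split; last by apply: ge_sup => //; exists 0.
by apply: ub_le_sup => //; exists c.
Qed.

(** * Replacing H by an approximation Hhat with H - Hhat = D^T D *)

Section Perturbation.
Variables (m n : nat) (Hhat : 'M[R]_n) (D : 'M[R]_(m, n)) (c : R).
Hypothesis Hhat_sym : Hhat^T = Hhat.
Hypothesis Hhat_psd : forall x : 'cV[R]_n, 0 <= mxdot x (Hhat *m x).
Hypothesis c_ge0 : 0 <= c.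
Hypothesis D_le : forall x : 'cV[R]_n, fro2 (D *m x) <= c * fro2 x.
Let H := Hhat + D^T *m D.

Let DD (x y : 'cV[R]_n) : mxdot x (D^T *m D *m y) = mxdot (D *m x) (D *m y).
Proof. by rewrite mxdot_mull mulmxA. Qed.

Lemma one_add_pd : sym_pd (1%:M + Hhat).
Proof.
split=> [|x x0]; first by rewrite linearD /= trmx1 Hhat_sym.
rewrite quad_mxdot mulmxDl mul1mx mxdotDr ltr_pwDl//.
by rewrite -/(fro2 _) lt_neqAle eq_sym fro2_eq0 x0 fro2_ge0.
Qed.

Let DD_le (x y : 'cV[R]_n) : mxdot x (D^T *m D *m y) ^+ 2 <= c ^+ 2 * fro2 x * fro2 y.
Proof.
rewrite DD; apply: le_trans (mxdot_CS _ _) _.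
by rewrite expr2 -mulrA mulrACA mulrA -mulrA ler_pM ?fro2_ge0// mulrA.
Qed.

(** The error e = v - u solves (I + Hhat) e = D^T D u. Testing with e and dropping the nonnegative
    Hhat term gives |e|^2 <= <e, D^T D u> <= c |e| |u|. *)
Lemma solution_error_le (b u v : 'cV[R]_n) :
  (1%:M + H) *m u = b -> (1%:M + Hhat) *m v = b -> norm2 (u - v) <= c * norm2 u.
Proof.
move=> hu hv; rewrite -(@ler_pXn2r _ 2) ?nnegrE ?mulr_ge0 ?norm2_ge0//.
rewrite exprMn !norm2_sqr -[u - v]opprB fro2N; set e := v - u.
have ee : (1%:M + Hhat) *m e = D^T *m D *m u.
  rewrite mulmxBr hv -hu /H addrA mulmxDl.
  by rewrite addrAC subrr add0r.
have e1 : fro2 e <= mxdot e (D^T *m D *m u).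
  by rewrite -ee mulmxDl mul1mx mxdotDr lerDl.
have e2 : fro2 e ^+ 2 <= c ^+ 2 * fro2 e * fro2 u.
  by apply: le_trans (DD_le _ _); rewrite ler_pXn2r ?nnegrE// ?(le_trans _ e1) ?fro2_ge0.
have [->|e0] := eqVneq (fro2 e) 0; first by rewrite mulr_ge0 ?fro2_ge0 ?sqr_ge0.
have ep : 0 < fro2 e by rewrite lt_neqAle eq_sym e0 fro2_ge0.
by move: e2; rewrite expr2 mulrAC [leRHS]mulrC ler_pM2l.
Qed.

(** With T = (I + Hhat)^{1/2} the operator is I + E, where E = T^{-1} D^T D T^{-1}. Positivity of E
    gives an inverse of norm at most 1. Since T^2 >= I, T^{-1} is a contraction, hence |E| <= c and
    |I + E| <= 1 + c. *)
Lemma cond2_precond_bounds : 0 <= cond2 (precond H Hhat) <= 1 + c.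
Proof.
have pd := one_add_pd; have [sT TT] := sqrtmxP pd; have uT := sqrtmx_unit pd.
rewrite /cond2 /precond; set T := sqrtmx _ in sT TT uT *.
set M := _ *m invmx T.
have ME : M = 1%:M + invmx T *m (D^T *m D) *m invmx T.
  by rewrite /M /H addrA mulmxDr mulmxDl -TT mulmxA mulVmx// mul1mx mulmxV.
have sTi : (invmx T)^T = invmx T by rewrite trmx_inv sT.
have Ti_le (x : 'cV[R]_n) : fro2 (invmx T *m x) <= fro2 x.
  set y := _ *m x; have -> : x = T *m y by rewrite mulKVmx.
  by rewrite {2}/fro2 mxdot_mull sT mulmxA TT mulmxDl mul1mx mxdotDr lerDl.
set E := invmx T *m (D^T *m D) *m invmx T in ME.
have EDD (x y : 'cV[R]_n) : mxdot x (E *m y) = mxdot (invmx T *m x) (D^T *m D *m (invmx T *m y)).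
  by rewrite mxdot_mull sTi /E !mulmxA.
have E_psd (x : 'cV[R]_n) : 0 <= mxdot x (E *m x) by rewrite EDD DD fro2_ge0.
have E_le (x : 'cV[R]_n) : fro2 (E *m x) <= c ^+ 2 * fro2 x.
  have := DD_le (invmx T *m (E *m x)) (invmx T *m x); rewrite -EDD -/(fro2 (E *m x)) => h.
  have {}h : fro2 (E *m x) ^+ 2 <= c ^+ 2 * fro2 (E *m x) * fro2 x.
    apply: le_trans h _; apply: ler_pM; rewrite ?mulr_ge0 ?sqr_ge0 ?fro2_ge0//.
    by rewrite ler_wpM2l ?sqr_ge0.
  have [->|e0] := eqVneq (fro2 (E *m x)) 0; first by rewrite mulr_ge0 ?fro2_ge0 ?sqr_ge0.
  have ep : 0 < fro2 (E *m x) by rewrite lt_neqAle eq_sym e0 fro2_ge0.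
  by move: h; rewrite expr2 mulrAC [leRHS]mulrC ler_pM2l.
have Mx_ge (x : 'cV[R]_n) : fro2 x <= fro2 (M *m x).
  rewrite ME mulmxDl mul1mx {2}/fro2 !(mxdotDl, mxdotDr) (mxdotC (E *m x)) -!/(fro2 _).
  by have := E_psd x; have := fro2_ge0 (E *m x); lra.
have Mu : M \in unitmx.
  rewrite -unitmx_tr -row_free_unit -kermx_eq0; apply/eqP/row_matrixP => i.
  rewrite row0; set v := row i _; apply/eqP; rewrite -trmx_eq0 -fro2_eq0 eq_le fro2_ge0.
  apply/andP; split=> //; apply: le_trans (Mx_ge _) _.
  rewrite -[M *m _]trmxK trmx_mul trmxK -row_mul mulmx_ker row0 trmx0.
  by rewrite le_eqVlt fro2_eq0 eqxx.
have /andP[n0 n1] : 0 <= specnorm M <= 1 + c.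
  apply: specnorm_le => [|x]; first by rewrite addr_ge0.
  rewrite ME mulmxDl mul1mx {1}/fro2 !(mxdotDl, mxdotDr) (mxdotC (E *m x)) -!/(fro2 _).
  have cs : mxdot x (E *m x) <= c * fro2 x.
    rewrite -(@ler_pXn2r _ 2) ?nnegrE ?mulr_ge0 ?fro2_ge0//.
    apply: le_trans (mxdot_CS _ _) _.
    by rewrite exprMn [fro2 x ^+ 2]expr2 mulrCA ler_wpM2l ?fro2_ge0.
  have := E_le x; have -> : (1 + c) ^+ 2 = 1 + 2 * c + c ^+ 2 by ring.
  by rewrite !mulrDl mul1r -mulrA; lra.
have /andP[i0 i1] : 0 <= specnorm (invmx M) <= 1.
  apply: specnorm_le => // x; rewrite expr1n mul1r.
  by apply: le_trans (Mx_ge _) _; rewrite mulKVmx.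
by rewrite mulr_ge0//=; apply: le_trans (ler_pM _ _ n1 i1) _; rewrite ?mulr1.
Qed.

End Perturbation.
End Sketch.

(** * Deterministic projection error *)

Section SingularValues.
Variable R : realType.

Lemma lam_ge0 m (sigma : 'I_m -> R) k : 0 <= lam sigma k.
Proof. by rewrite /lam; case: insub => // i; rewrite sqr_ge0. Qed.

Lemma lam_anti m n (A : 'M[R]_(m, n)) (sigma : 'I_m -> R) j k :
  singular_values A sigma -> (j <= k)%N -> lam sigma k <= lam sigma j.
Proof.
move=> [s0 sa _] jk; rewrite /lam; case: insubP => [k' km k'E|_]; last exact: (lam_ge0 sigma).
case: insubP => [j' jm j'E|]; last by rewrite (leq_ltn_trans jk).
by rewrite ler_pXn2r ?nnegrE// sa// j'E k'E.
Qed.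

Lemma fro2_diag_quad n (d : 'rV[R]_n) (y : 'cV[R]_n) :
  mxdot y (diag_mx d *m y) = \sum_k d 0 k * y k 0 ^+ 2.
Proof.
rewrite mxdotE; apply: eq_bigr => k _; rewrite big_ord1 mul_diag_mx mxE.
by rewrite expr2 mulrCA.
Qed.

(** In the basis V both A^T A and I - V1 V1^T are diagonal, with entries lambda_k and the indicator
    of k >= r, so each clause is a computation with diagonal matrices. The third clause keeps the
    projected vector on the right, to be combined without loss with a bound on the V1 component. *)
Lemma svd_split m n r (A : 'M[R]_(m, n)) (sigma : 'I_m -> R) :
  (r <= n)%N -> singular_values A sigma ->
  exists V1 : 'M[R]_(n, r), let B := A *m (1%:M - V1 *m V1^T) in
  [/\ V1^T *m V1 = 1%:M, (A *m V1)^T *m B = 0,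
      forall x : 'cV[R]_n,
        fro2 (B *m x) <= lam sigma r * fro2 ((1%:M - V1 *m V1^T) *m x)
    & fro2 B = tail_sum sigma n r].
Proof.
move=> rn hA; case: (hA) => s0 sa [U [V [UU VV AE]]].
have VV' : V *m V^T = 1%:M by exact: mulmx1C.
(* E selects the first r coordinates, so V E consists of the leading right singular vectors; N marks
   the remaining indices. *)
pose E : 'M[R]_(n, r) := \matrix_(i, j) (i == j :> nat)%:R.
pose L : 'rV[R]_n := \row_k lam sigma k.
pose N : 'rV[R]_n := \row_k (r <= k)%N%:R.
have EtE : E^T *m E = 1%:M.
  apply/matrixP => i j; rewrite !mxE (bigD1 (widen_ord rn i))//= !mxE eqxx mul1r.
  rewrite big1 ?addr0// => k /eqP ki; rewrite !mxE; case: eqP => [ki'|]; rewrite ?mul0r//.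
  by case: ki; apply: val_inj.
have EEt : E *m E^T = 1%:M - diag_mx N.
  apply/matrixP => i j; rewrite !mxE.
  have [ri|ir] := leqP r i.
    rewrite subrr big1// => k _; rewrite !mxE gtn_eqF ?mul0r// (leq_trans (ltn_ord k))//.
  rewrite mul0rn subr0 (bigD1 (Ordinal ir))//= big1 => [|k /eqP ki].
    by rewrite !mxE eqxx mul1r addr0 eq_sym.
  by rewrite !mxE; case: eqP => [ki'|]; rewrite ?mul0r//; case: ki; apply: val_inj.
have AA : A^T *m A = V *m diag_mx L *m V^T.
  rewrite AE !trmx_mul trmxK !mulmxA -(mulmxA _ U^T U) UU mulmx1 -!mulmxA; congr (_ *m _).
  rewrite !mulmxA; congr (_ *m _); apply/matrixP => i j; rewrite !mxE.
  under eq_bigr do rewrite !mxE.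
  (* Columns of the rectangular factor with index at least m are zero, in agreement with the default
     value of [lam]. *)
  rewrite /lam; case: insubP => [k km kE|km].
    rewrite (bigD1 k)//= big1 => [|l /eqP lk]; rewrite ?kE.
      by rewrite eqxx addr0 expr2 -mulrnAr.
    by case: eqP => [li|_]; [case: lk; apply: val_inj; rewrite kE|rewrite mulr0n mul0r].
  rewrite mul0rn big1// => k _; case: eqP => [ki|_]; rewrite ?mulr0n ?mul0r//.
  by rewrite -ki ltn_ord in km.
pose V1 := V *m E.
have Pi : 1%:M - V1 *m V1^T = V *m diag_mx N *m V^T.
  rewrite /V1 trmx_mul !mulmxA -(mulmxA V) EEt mulmxBr mulmx1 mulmxBl VV'.
  by rewrite opprB addrCA subrr addr0.
have NtN : (V *m diag_mx N *m V^T)^T = V *m diag_mx N *m V^T.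
  by rewrite !trmx_mul trmxK tr_diag_mx mulmxA.
have LN : diag_mx N *m diag_mx L *m diag_mx N = diag_mx (\row_k (lam sigma k * N 0 k)).
  rewrite !mulmx_diag; congr diag_mx; apply/rowP => k; rewrite !mxE.
  by case: (r <= k)%N; rewrite ?(mul0r, mul1r, mulr0).
pose Pm := V *m diag_mx N *m V^T.
have PmT : Pm^T = Pm by exact: NtN.
set B := A *m (1%:M - V1 *m V1^T).
have BE : B = A *m Pm by rewrite /B Pi.
have BB : B^T *m B = V *m diag_mx (\row_k (lam sigma k * N 0 k)) *m V^T.
  have -> : B^T *m B = Pm *m (A^T *m A) *m Pm by rewrite BE trmx_mul PmT !mulmxA.
  by rewrite AA -LN /Pm !mulmxA -!(mulmxA _ V^T V) !VV !mulmx1.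
have Pm2 : Pm^T *m Pm = Pm.
  rewrite PmT /Pm !mulmxA -!(mulmxA _ V^T V) !VV !mulmx1 -(mulmxA V) mulmx_diag.
  congr (_ *m diag_mx _ *m _); apply/rowP => k; rewrite !mxE.
  by case: (r <= k)%N; rewrite ?mulr1 ?mulr0.
have quadV (d : 'rV[R]_n) (x : 'cV[R]_n) :
    mxdot x (V *m diag_mx d *m V^T *m x) = \sum_k d 0 k * (V^T *m x) k 0 ^+ 2.
  by rewrite -fro2_diag_quad mxdot_mull trmxK !mulmxA.
exists V1; split.
- by rewrite /V1 trmx_mul mulmxA -(mulmxA _ V^T V) VV mulmx1.
- have -> : (A *m V1)^T *m B = V1^T *m (A^T *m A) *m Pm by rewrite BE trmx_mul !mulmxA.
  rewrite AA /Pm /V1 trmx_mul !mulmxA -!(mulmxA _ V^T V) !VV !mulmx1.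
  rewrite (_ : E^T *m _ *m _ = 0) ?mul0mx//.
  rewrite -mulmxA mulmx_diag; apply/matrixP => i j; rewrite mul_mx_diag !mxE.
  have [ji|] := eqVneq (j : nat) i; rewrite ?mul0r//.
  by rewrite ji leqNgt ltn_ord mulr0 mulr0.
- move=> x; rewrite -/B Pi -/Pm /fro2 !mxdot_mull (mulmxA B^T) (mulmxA Pm^T) BB Pm2.
  rewrite !quadV mulr_sumr.
  apply: ler_sum => k _; rewrite !mxE mulrA ler_wpM2r ?sqr_ge0//.
  by case: (leqP r k) => rk; rewrite ?mulr0// !mulr1 (lam_anti hA).
rewrite /fro2 /mxdot BB mxtrace_mulC mulmxA VV mul1mx mxtrace_diag.
rewrite /tail_sum (big_nat_widenl _ 0%N)// big_mkord [RHS]big_mkcond /=.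
by apply: eq_bigr => k _; rewrite !mxE; case: (r <= k)%N; rewrite ?mulr1 ?mulr0.
Qed.

(** The vectors V1^T x and (I - V1 V1^T) x split |x|^2, and |C a + B x| is at most |C|_F |a| + sqrt
    l |b|; Cauchy-Schwarz on this sum of two products gives the factor l + |C|_F^2. *)
Lemma residual_le m n r (A : 'M[R]_(m, n)) (V1 C : 'M[R]_(_, r)) (l : R) (x : 'cV[R]_n) :
  let B := A *m (1%:M - V1 *m V1^T) in
  V1^T *m V1 = 1%:M -> 0 <= l ->
  (forall x : 'cV[R]_n, fro2 (B *m x) <= l * fro2 ((1%:M - V1 *m V1^T) *m x)) ->
  fro2 ((C *m V1^T + B) *m x) <= (l + fro2 C) * fro2 x.
Proof.
move=> B VV l0 /(_ x) hB; rewrite mulmxDl -mulmxA.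
set a := V1^T *m x; set b := (1%:M - _) *m x in hB.
have xE : fro2 x = fro2 a + fro2 b.
  have -> : fro2 a = fro2 (V1 *m a) by rewrite /fro2 [RHS]mxdot_mull mulmxA VV mul1mx.
  rewrite -fro2D_orth; last first.
    rewrite /b mulmxBl mul1mx -mulmxA -/a mxdotDr mxdotNr !(mxdot_mull V1) mulmxA VV mul1mx.
    by rewrite subrr.
  by rewrite /b mulmxBl mul1mx -mulmxA -/a addrC subrK.
have hC := fro2_mul_le C a; have cs := mxdot_CS (C *m a) (B *m x).
rewrite /fro2 !(mxdotDl, mxdotDr) (mxdotC (B *m x)) -!/(fro2 _) xE.
move: hC hB cs (fro2_ge0 (C *m a)) (fro2_ge0 (B *m x)) (fro2_ge0 a) (fro2_ge0 b) (fro2_ge0 C).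
move: (mxdot _ _) (fro2 (_ *m a)) (fro2 (B *m x)) (fro2 a) (fro2 b) (fro2 C).
move=> d p q al be F pF ql dpq p0 q0 al0 be0 F0.
(* The four factors are regrouped so that the arithmetic-geometric mean inequality yields exactly
   the cross terms of (l + F)(al + be). *)
have d2 : d ^+ 2 <= (F * be) * (l * al).
  apply: le_trans dpq _; apply: le_trans (ler_pM p0 q0 pF ql) _.
  by rewrite le_eqVlt; apply/orP; left; apply/eqP; ring.
have u0 : 0 <= F * be by rewrite mulr_ge0.
have v0 : 0 <= l * al by rewrite mulr_ge0.
have : 2 * d <= F * be + l * al.
  rewrite (le_trans (ler_norm _))// -(@ler_pXn2r _ 2) ?nnegrE ?addr_ge0//.
  rewrite real_normK ?num_real// exprMn.
  by have := sqr_ge0 (F * be - l * al); move: d2 => /[swap]; nra.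
by rewrite !mulrDr !mulrDl => h; lra.
Qed.

Lemma thin_qr_residual_le m n l (A : 'M[R]_(m, n)) (Om : 'M[R]_(n, l)) Q S
    (Z : 'M[R]_(l, n)) (x : 'cV[R]_n) :
  thin_qr (A *m Om) Q S ->
  fro2 ((1%:M - Q *m Q^T) *m A *m x) <= fro2 ((A - A *m Om *m Z) *m x).
Proof.
move=> [QQ _ YE]; set P := 1%:M - Q *m Q^T.
have PY : P *m (A *m Om) = 0.
  by rewrite YE mulmxBl mul1mx mulmxA -(mulmxA Q) QQ mulmx1 subrr.
have -> : P *m A *m x = P *m ((A - A *m Om *m Z) *m x).
  by rewrite (mulmxA P) mulmxBr (mulmxA P) PY mul0mx subr0.
move: ((A - _) *m x) => y.
have -> : fro2 y = fro2 (P *m y) + fro2 (Q *m (Q^T *m y)).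
  rewrite -fro2D_orth; last first.
    rewrite mxdotC mxdot_mull /P mulmxBl mul1mx mulmxBr !mulmxA QQ mul1mx subrr.
    by rewrite /mxdot mulmx0 mxtrace0.
  by rewrite mulmxBl mul1mx -mulmxA subrK.
by rewrite lerDl fro2_ge0.
Qed.

End SingularValues.

(** * The regularized right inverse and its trace identities *)

Section RegularizedGram.
Variable R : realType.
Variables (n r l : nat) (V1 : 'M[R]_(n, r)) (e : R).
Hypothesis e_gt0 : 0 < e.

(* [gramS] is the regularized inverse [(G G^T + e I)^{-1}] for [G = V1^T M], and
   [gramK] the resulting regularized right inverse of [G]. *)
Definition gramW (M : 'M[R]_(n, l)) : 'M[R]_r := V1^T *m M *m (V1^T *m M)^T + e%:M.
Definition gramS (M : 'M[R]_(n, l)) : 'M[R]_r := invmx (gramW M).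
Definition gramK (M : 'M[R]_(n, l)) : 'M[R]_(l, r) := (V1^T *m M)^T *m gramS M.
(** With G = V1^T M this is G^T S G, the regularized orthogonal projection onto the row space of
    G. *)
Definition gramP (M : 'M[R]_(n, l)) : 'M[R]_l := gramK M *m (V1^T *m M).

Lemma gramW_pd M : sym_pd (gramW M).
Proof.
split=> [|x x0]; first by rewrite linearD /= trmx_mul trmxK tr_scalar_mx.
rewrite quad_mxdot /gramW; set G := V1^T *m M.
rewrite mulmxDl mxdotDr mul_scalar_mx mxdotZr -(mulmxA G) -{1}[G]trmxK.
rewrite -mxdot_mull ltr_wpDl ?fro2_ge0// mulr_gt0//.
by rewrite lt_neqAle eq_sym fro2_eq0 x0 fro2_ge0.
Qed.

Lemma gramW_unit M : gramW M \in unitmx.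
Proof. exact/sym_pd_unit/gramW_pd. Qed.

Lemma gramS_sym M : (gramS M)^T = gramS M.
Proof. by rewrite trmx_inv (proj1 (gramW_pd M)). Qed.

Lemma gramK_tr M : (gramK M)^T = gramS M *m (V1^T *m M).
Proof. by rewrite trmx_mul trmxK gramS_sym. Qed.

(** This is W S = I with W = G G^T + e I. The defect e S is what regularization costs, and the trace
    and norm identities below all derive from it. *)
Lemma mul_gramK M : V1^T *m M *m gramK M = 1%:M - e *: gramS M.
Proof.
have := mulmxV (gramW_unit M); rewrite -/(gramS M) /gramW mulmxDl mul_scalar_mx => <-.
by rewrite addrK mulmxA.
Qed.

Lemma fro2_gramK M : fro2 (gramK M) = \tr (gramS M) - e * fro2 (gramS M).
Proof.
rewrite /fro2 {1}/mxdot gramK_tr -mulmxA mul_gramK mulmxBr mulmx1 -scalemxAr.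
by rewrite linearB linearZ /= /mxdot gramS_sym.
Qed.

Lemma gramP_sym M : (gramP M)^T = gramP M.
Proof. by rewrite [LHS]trmx_mul gramK_tr /gramP /gramK -(mulmxA _ (gramS M)). Qed.

Lemma tr_gramP M : \tr (gramP M) = r%:R - e * \tr (gramS M).
Proof. by rewrite /gramP mxtrace_mulC mul_gramK linearB linearZ /= mxtrace1. Qed.

Lemma fro2_gramP M : fro2 (gramP M) = \tr (gramP M) - e * fro2 (gramK M).
Proof.
rewrite /fro2 {1}/mxdot gramP_sym {1}/gramP -mulmxA (mulmxA (V1^T *m M)) mul_gramK.
rewrite mulmxBl mul1mx mulmxBr linearB /= -/(gramP M) -scalemxAl -scalemxAr linearZ /=.
by congr (_ - _ * _); rewrite -gramK_tr /mxdot mxtrace_mulC.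
Qed.

Lemma tr_gramS_ge0 M : 0 <= \tr (gramS M).
Proof.
have := fro2_ge0 (gramK M); rewrite fro2_gramK subr_ge0; apply: le_trans.
by rewrite mulr_ge0 ?fro2_ge0 ?ltW.
Qed.

(** From 0 <= |P|_F^2 <= tr P = r - e tr S. The bound blows up as e tends to 0; it serves the growth
    conditions of integration by parts, while the final constant comes from the exact identities. *)
Lemma tr_gramS_le M : \tr (gramS M) <= r%:R / e.
Proof.
have := fro2_ge0 (gramP M); rewrite fro2_gramP tr_gramP => h.
rewrite ler_pdivlMr// mulrC -subr_ge0; apply: le_trans h _.
by rewrite gerBl mulr_ge0 ?fro2_ge0 ?ltW.
Qed.

Lemma fro2_gramK_le M : fro2 (gramK M) <= \tr (gramS M).
Proof. by rewrite fro2_gramK gerBl mulr_ge0 ?fro2_ge0 ?ltW. Qed.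

Lemma fro2_gramS_le M : e * fro2 (gramS M) <= \tr (gramS M).
Proof. by have := fro2_ge0 (gramK M); rewrite fro2_gramK subr_ge0. Qed.

Lemma fro2_gramP_le M : fro2 (gramP M) <= r%:R.
Proof.
rewrite fro2_gramP tr_gramP -addrA gerDl -opprD oppr_le0.
by rewrite addr_ge0// mulr_ge0 ?fro2_ge0 ?tr_gramS_ge0 ?ltW.
Qed.

End RegularizedGram.

(** * Derivatives of the regularized inverse *)

Section FunctionAlgebra.
Variables (R : realType) (T : Type) (Cl : (T -> R) -> Prop).

(* Covers both derivable and measurable functions, so that the rational
   dependence of a matrix inverse on the entries is treated once. *)
Record fun_algebra : Prop := FunAlgebra {
  fa_cst : forall c, Cl (fun _ => c);
  fa_add : forall f g, Cl f -> Cl g -> Cl (fun t => f t + g t);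
  fa_mul : forall f g, Cl f -> Cl g -> Cl (fun t => f t * g t);
  fa_inv : forall f, (forall t, f t != 0) -> Cl f -> Cl (fun t => (f t)^-1) }.

Hypothesis fa : fun_algebra.

Definition mx_in m n (f : T -> 'M[R]_(m, n)) : Prop := forall i j, Cl (fun t => f t i j).

Lemma fa_sum (I : Type) (s : seq I) (P : pred I) (f : I -> T -> R) :
  (forall i, Cl (f i)) -> Cl (fun t => \sum_(i <- s | P i) f i t).
Proof.
move=> hf; elim: s => [|i s ih].
  by under eq_fun do rewrite big_nil; exact: (fa_cst fa).
under eq_fun do rewrite big_cons; case: (P i) => //.
exact: fa_add.
Qed.

Lemma fa_prod (I : Type) (s : seq I) (P : pred I) (f : I -> T -> R) :
  (forall i, Cl (f i)) -> Cl (fun t => \prod_(i <- s | P i) f i t).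
Proof.
move=> hf; elim: s => [|i s ih].
  by under eq_fun do rewrite big_nil; exact: (fa_cst fa).
under eq_fun do rewrite big_cons; case: (P i) => //.
exact: fa_mul.
Qed.

Lemma mx_in_cst m n (A : 'M[R]_(m, n)) : mx_in (fun _ => A).
Proof. by move=> i j; exact: (fa_cst fa). Qed.

Lemma mx_in_tr m n (f : T -> 'M[R]_(m, n)) : mx_in f -> mx_in (fun t => (f t)^T).
Proof. by move=> hf i j; under eq_fun do rewrite mxE; exact: hf. Qed.

Lemma mx_in_add m n (f g : T -> 'M[R]_(m, n)) :
  mx_in f -> mx_in g -> mx_in (fun t => f t + g t).
Proof. by move=> hf hg i j; under eq_fun do rewrite mxE; exact: fa_add. Qed.

Lemma mx_in_mul m n p (f : T -> 'M[R]_(m, n)) (g : T -> 'M[R]_(n, p)) :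
  mx_in f -> mx_in g -> mx_in (fun t => f t *m g t).
Proof.
move=> hf hg i j; under eq_fun do rewrite mxE.
by apply: fa_sum => k; exact: fa_mul.
Qed.

Lemma mx_in_scale m n a (f : T -> 'M[R]_(m, n)) : mx_in f -> mx_in (fun t => a *: f t).
Proof.
by move=> hf i j; under eq_fun do rewrite mxE; apply: (fa_mul fa) => //; exact: (fa_cst fa).
Qed.

Lemma fa_det n (f : T -> 'M[R]_n) : mx_in f -> Cl (fun t => \det (f t)).
Proof.
move=> hf; apply: fa_sum => s; apply: (fa_mul fa); first exact: (fa_cst fa).
exact: fa_prod.
Qed.

(** Cramer's rule: each entry is a cofactor divided by a nonvanishing determinant. *)
Lemma mx_in_inv n (f : T -> 'M[R]_n) :
  (forall t, f t \in unitmx) -> mx_in f -> mx_in (fun t => invmx (f t)).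
Proof.
move=> fu hf i j.
have -> : (fun t => invmx (f t) i j) = (fun t => (\det (f t))^-1 * cofactor (f t) j i).
  by apply/funext => t; rewrite /invmx fu !mxE.
apply: (fa_mul fa).
  by apply: (fa_inv fa); [move=> t; have := fu t; rewrite unitmxE unitfE|exact: fa_det].
apply: (fa_mul fa); first exact: (fa_cst fa).
by apply: fa_det => k l; under eq_fun do rewrite !mxE; exact: hf.
Qed.

Section Gram.
Variables (n r l : nat) (V1 : 'M[R]_(n, r)) (e : R).
Hypothesis e_gt0 : 0 < e.
Variable f : T -> 'M[R]_(n, l).
Hypothesis hf : mx_in f.

Let mx_in_G : mx_in (fun t => V1^T *m f t).
Proof. by apply: mx_in_mul => //; exact: mx_in_cst. Qed.

Lemma mx_in_gramS : mx_in (fun t => gramS V1 e (f t)).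
Proof.
apply: mx_in_inv => [t|]; first exact: gramW_unit.
apply: mx_in_add; last exact: mx_in_cst.
by apply: mx_in_mul => //; exact: mx_in_tr.
Qed.

Lemma mx_in_gramK : mx_in (fun t => gramK V1 e (f t)).
Proof. by apply: mx_in_mul; [exact: mx_in_tr|exact: mx_in_gramS]. Qed.

Lemma mx_in_gramP : mx_in (fun t => gramP V1 e (f t)).
Proof. by apply: mx_in_mul => //; exact: mx_in_gramK. Qed.

End Gram.
End FunctionAlgebra.

Lemma measurable_fun_algebra d (T : measurableType d) (R : realType) :
  fun_algebra (fun f : T -> R => measurable_fun setT f).
Proof.
split=> [c|f g|f g|f _] //; [exact: measurable_funD|exact: measurable_funM|].
(* The reciprocal is written f (f^2)^{-1}, so that the power function acts on a nonnegative base. *)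
move=> mf; have -> : (fun t => (f t)^-1) = (fun t => f t * powR (f t ^+ 2) (-1)).
  apply/funext => t; have [->|f0] := eqVneq (f t) 0; first by rewrite invr0 mul0r.
  by rewrite powR_inv1 ?sqr_ge0// expr2 invfM mulrA divff// mul1r.
apply: measurable_funM => //; apply: (measurableT_comp (measurable_powR _)) => //.
exact: measurable_funX.
Qed.

Lemma derivable_fun_algebra (R : realType) (t : R) :
  fun_algebra (fun f : R -> R => derivable f t 1).
Proof.
split=> [c|f g|f g|f f0]; [exact: derivable_cst|exact: derivableD|exact: derivableM|].
exact: derivableV.
Qed.

Section MatrixDerivative.
Variable R : realType.
Implicit Types t : R.

Definition mx_is_derive m n t (f : R -> 'M[R]_(m, n)) (df : 'M[R]_(m, n)) : Prop :=
  forall i j, is_derive t 1 (fun s => f s i j) (df i j).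

Lemma mx_is_derive_unique m n t (f : R -> 'M[R]_(m, n)) df df' :
  mx_is_derive t f df -> mx_is_derive t f df' -> df = df'.
Proof.
move=> h h'; apply/matrixP => i j.
by have := h i j; have := h' i j => -[_ <-] [_ <-].
Qed.

Lemma mx_is_derive_cst m n t (A : 'M[R]_(m, n)) : mx_is_derive t (fun _ => A) 0.
Proof. by move=> i j; rewrite mxE; exact: is_derive_cst. Qed.

Lemma mx_is_derive_line m n t (A D : 'M[R]_(m, n)) :
  mx_is_derive t (fun s => A + s *: D) D.
Proof.
move=> i j; have -> : (fun s => (A + s *: D) i j) = cst (A i j) + (D i j) \*: id.
  by apply/funext => s; rewrite /= !mxE mulrC.
by apply: is_derive_eq; rewrite add0r /GRing.scale /= mulr1.
Qed.

Lemma mx_is_derive_tr m n t (f : R -> 'M[R]_(m, n)) df :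
  mx_is_derive t f df -> mx_is_derive t (fun s => (f s)^T) df^T.
Proof. by move=> h i j; rewrite mxE; under eq_fun do rewrite mxE; exact: h. Qed.

Lemma mx_is_derive_add m n t (f g : R -> 'M[R]_(m, n)) df dg :
  mx_is_derive t f df -> mx_is_derive t g dg ->
  mx_is_derive t (fun s => f s + g s) (df + dg).
Proof.
move=> hf hg i j; rewrite mxE; under eq_fun do rewrite mxE.
exact: is_deriveD.
Qed.

Lemma mx_is_derive_mul m n p t (f : R -> 'M[R]_(m, n)) (g : R -> 'M[R]_(n, p)) df dg :
  mx_is_derive t f df -> mx_is_derive t g dg ->
  mx_is_derive t (fun s => f s *m g s) (df *m g t + f t *m dg).
Proof.
move=> hf hg i j.
have -> : (fun s => (f s *m g s) i j) = \sum_(k < n) (fun s => f s i k * g s k j).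
  by apply/funext => s; rewrite mxE fct_sumE.
have -> : (df *m g t + f t *m dg) i j = \sum_(k < n) (f t i k *: dg k j + g t k j *: df i k).
  rewrite !mxE -big_split; apply: eq_bigr => k _ /=.
  by rewrite addrC [g t k j *: _]mulrC.
by apply: is_derive_sum => k; exact: is_deriveM.
Qed.

(** Cramer's rule gives derivability of the inverse; differentiating f f^{-1} = I then forces the
    value. *)
Lemma mx_is_derive_inv n t (f : R -> 'M[R]_n) df :
  (forall s, f s \in unitmx) -> mx_is_derive t f df ->
  mx_is_derive t (fun s => invmx (f s)) (- (invmx (f t) *m df *m invmx (f t))).
Proof.
move=> fu hf; pose dS : 'M[R]_n := \matrix_(i, j) 'D_1 (fun s => invmx (f s) i j) t.
have hS : mx_is_derive t (fun s => invmx (f s)) dS.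
  move=> i j; rewrite mxE; apply/derivableP.
  by apply: (mx_in_inv (derivable_fun_algebra t)) => // k l; case: (hf k l).
suff <- : dS = - (invmx (f t) *m df *m invmx (f t)) by [].
have : df *m invmx (f t) + f t *m dS = 0.
  apply: mx_is_derive_unique (mx_is_derive_mul hf hS) _.
  by under [X in mx_is_derive _ X]eq_fun do rewrite mulmxV//; exact: mx_is_derive_cst.
move/(congr1 (mulmx (invmx (f t)))); rewrite mulmx0 mulmxDr mulKmx// mulmxA addrC.
by move/eqP; rewrite addr_eq0 => /eqP.
Qed.

(** Differentiating K = G^T S produces D^T S - G^T S (D G^T + G D^T) S. The terms in D^T combine
    into (I - P) D^T S, and the other one is K D K. *)
Lemma mx_is_derive_gramK n r l (V1 : 'M[R]_(n, r)) (e : R) t (M N : 'M[R]_(n, l)) :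
  0 < e ->
  let D := V1^T *m N in let Mt := M + t *: N in
  mx_is_derive t (fun s => gramK V1 e (M + s *: N))
    ((1%:M - gramP V1 e Mt) *m D^T *m gramS V1 e Mt - gramK V1 e Mt *m D *m gramK V1 e Mt).
Proof.
move=> e0 D Mt.
have hG : mx_is_derive t (fun s => V1^T *m (M + s *: N)) D.
  have := mx_is_derive_mul (mx_is_derive_cst t V1^T) (mx_is_derive_line t M N).
  by rewrite mul0mx add0r.
have hW : mx_is_derive t (fun s => gramW V1 e (M + s *: N))
    (D *m (V1^T *m Mt)^T + V1^T *m Mt *m D^T).
  rewrite -[X in mx_is_derive _ _ X]addr0; apply: mx_is_derive_add (mx_is_derive_cst _ _).
  exact: mx_is_derive_mul hG (mx_is_derive_tr hG).
have hS := mx_is_derive_inv (fun s => gramW_unit V1 e0 (M + s *: N)) hW.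
have := mx_is_derive_mul (mx_is_derive_tr hG) hS.
rewrite -/Mt -/(gramS V1 e Mt); congr mx_is_derive.
rewrite !mulmxBl mul1mx -addrA; congr (_ + _); rewrite mulmxN -opprD; congr (- _).
rewrite addrC /gramP /gramK; move: (gramS V1 e Mt) (V1^T *m Mt) (D) => S G D'.
by rewrite mulmxDr mulmxDl mulmxDr !mulmxA.
Qed.

End MatrixDerivative.

(** * Gaussian integration by parts *)

Local Open Scope classical_set_scope.
Local Open Scope ring_scope.

Section StandardNormal.
Variable R : realType.
Local Notation mu := (@lebesgue_measure R).
Local Notation gauss := (@normal_prob R 0 1).
Local Notation phi := (@normal_pdf R 0 1).

(** The Radon-Nikodym derivative of the normal law and the explicit density have the same integral
    over every measurable set, hence agree almost everywhere. *)
Lemma ge0_integral_std_normal (f : R -> \bar R) :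
  measurable_fun setT f -> (forall x, 0 <= f x)%E ->
  (\int[gauss]_x f x = \int[mu]_x (f x * (phi x)%:E))%E.
Proof.
move=> mf f0; have dom := normal_prob_dominates 0 (1 : R).
rewrite -(Radon_Nikodym_SigmaFinite.change_of_variables dom)//.
have mg := measurable_int mu (Radon_Nikodym_SigmaFinite.f_integrable dom).
have mphi : measurable_fun setT (EFin \o phi).
  by apply/measurable_EFinP; exact: measurable_normal_pdf.
apply: ae_eq_integral => //; [exact: emeasurable_funM|exact: emeasurable_funM|].
apply: ae_eqe_mul2l => /=.
apply: integral_ae_eq => //; first exact: Radon_Nikodym_SigmaFinite.f_integrable.
by move=> E _ mE; rewrite -Radon_Nikodym_SigmaFinite.f_integral.
Qed.

Lemma integral_std_normal (f : R -> R) : measurable_fun setT f ->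
  (\int[gauss]_x (f x)%:E = \int[mu]_x (f x * phi x)%:E)%E.
Proof.
move=> mf; have mEf : measurable_fun setT (EFin \o f) by exact/measurable_EFinP.
rewrite integralE [RHS]integralE; congr (_ - _)%E.
  rewrite ge0_integral_std_normal//; last exact: measurable_funepos.
  apply: eq_integral => x _; rewrite !funeposE muleC maxe_pMr ?lee_fin ?normal_pdf_ge0//.
  by rewrite mule0 -EFinM mulrC.
rewrite ge0_integral_std_normal//; last exact: measurable_funeneg.
apply: eq_integral => x _; rewrite !funenegE muleC maxe_pMr ?lee_fin ?normal_pdf_ge0//.
by rewrite mule0 -!EFinN -EFinM mulrN mulrC.
Qed.

Lemma std_normal_pdfE x : phi x = normal_peak 1 * expR (- (x ^+ 2 / 2)).
Proof.
rewrite normal_pdfE ?oner_neq0// /normal_fun subr0 expr1n.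
by congr (_ * expR _); rewrite mulNr.
Qed.

(** Half of the Gaussian exponent absorbs the quadratic factor: 1 + x^2 <= 4 (1 + x^2/4) <= 4
    exp(x^2/4). What remains is a multiple of the normal density of variance 2. *)
Lemma quadratic_pdf_le (x : R) :
  (1 + x ^+ 2) * phi x <= 4 * normal_peak 1 * expR (- (x ^+ 2 / 4)).
Proof.
rewrite std_normal_pdfE mulrCA -[leRHS]mulrA [leRHS]mulrCA ler_wpM2l ?normal_peak_ge0//.
have -> : - (x ^+ 2 / 2) = - (x ^+ 2 / 4) + - (x ^+ 2 / 4) by field.
rewrite expRD mulrA ler_wpM2r ?expR_ge0// expRN ler_pdivrMr ?expR_gt0//.
have := expR_ge1Dx (x ^+ 2 / 4); have := sqr_ge0 x; lra.
Qed.

Lemma integrable_quadratic_pdf : mu.-integrable setT (fun x => ((1 + x ^+ 2) * phi x)%:E).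
Proof.
have s0 : Num.sqrt 2 != 0 :> R by rewrite sqrtr_eq0 -ltNge.
pose k : R := 4 * normal_peak 1 / normal_peak (Num.sqrt 2).
have ik := integrableZl measurableT k (@integrable_normal_pdf R 0 (Num.sqrt 2)).
apply: le_integrable ik => //.
  apply/measurable_EFinP; apply: measurable_funM; last exact: measurable_normal_pdf.
  by apply: measurable_funD => //; exact: measurable_funX.
move=> x _ /=; rewrite lee_fin ger0_norm; last first.
  by rewrite mulr_ge0 ?normal_pdf_ge0 ?addr_ge0 ?sqr_ge0.
apply: le_trans (quadratic_pdf_le x) _; apply: le_trans (ler_norm _).
rewrite normal_pdfE// /normal_fun subr0 sqr_sqrtr// /k.
rewrite mulrA divfK ?gt_eqF ?normal_peak_gt0//.
by rewrite le_eqVlt; apply/orP; left; apply/eqP; congr (_ * expR _); rewrite mulNr; field.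
Qed.

Lemma integrable_std_normal_sqr :
  gauss.-integrable setT (fun x => (1 + x ^+ 2)%:E).
Proof.
have m1 : measurable_fun setT (fun x : R => 1 + x ^+ 2).
  by apply: measurable_funD => //; exact: measurable_funX.
apply/integrableP; split; first exact/measurable_EFinP.
rewrite ge0_integral_std_normal//; last first.
  by apply: measurableT_comp => //; exact/measurable_EFinP.
have /integrableP[_] := integrable_quadratic_pdf; apply: le_lt_trans.
rewrite le_eqVlt; apply/orP; left; apply/eqP; apply: eq_integral => x _.
by rewrite /= normrM EFinM [`|phi x|]ger0_norm ?normal_pdf_ge0.
Qed.

Lemma is_derive_std_normal_pdf (x : R) : is_derive x 1 phi (- (x * phi x)).
Proof.
have phiE : normal_peak 1 \*: (expR \o (fun y : R => - (y ^+ 2 / 2))) = phi.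
  by apply/funext => y; rewrite std_normal_pdfE.
rewrite -[X in is_derive _ _ X]phiE.
have h : is_derive x 1 (fun y : R => - (y ^+ 2 / 2)) (- x).
  have -> : (fun y : R => - (y ^+ 2 / 2)) = (- 2^-1) \*: (id ^+ 2).
    by apply/funext => y /=; rewrite /GRing.scale /= mulNr mulrC.
  by apply: is_derive_eq; rewrite /GRing.scale /= !mulr1; field.
apply: is_derive_eq; rewrite std_normal_pdfE /GRing.scale /=; ring.
Qed.

(** The integrand times the density is the derivative of -f phi. The fundamental theorem on growing
    intervals leaves boundary terms tending to 0, and dominated convergence identifies the limit of
    the integrals. *)
Lemma gaussian_ibp (f df : R -> R) (c : R) :
  (forall x : R, is_derive x 1 f (df x)) -> continuous df ->
  (forall x, `|f x| <= c * (1 + x ^+ 2)) ->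
  (forall x, `|x * f x - df x| <= c * (1 + x ^+ 2)) ->
  (\int[gauss]_x (x * f x - df x)%:E = 0)%E.
Proof.
move=> hf cdf fle gle.
have cf : continuous f.
  move=> x; apply: differentiable_continuous; apply/derivable1_diffP.
  by case: (hf x).
have cphi : continuous phi by apply: continuous_normal_pdf; exact: oner_neq0.
pose g x := x * f x - df x.
have cg : continuous g.
  by move=> x; apply: cvgB; [apply: cvgM; [exact: cvg_id|exact: cf]|exact: cdf].
have cgphi : continuous (fun x => g x * phi x) by move=> x; apply: cvgM; [exact: cg|exact: cphi].
pose F x := - (f x * phi x).
have dF (x : R) : is_derive x 1 F (g x * phi x).
  have -> : F = - (f * phi) by [].
  have hphi := is_derive_std_normal_pdf x; have hfx := hf x.
  by apply: is_derive_eq; rewrite /g /GRing.scale /=; ring.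
have cF : continuous F.
  move=> x; apply: differentiable_continuous; apply/derivable1_diffP.
  by case: (dF x).
rewrite integral_std_normal; last exact: continuous_measurable_fun.
pose I (k : nat) : set R := [set` `[- k.+1%:R : R, k.+1%:R]].
pose h (k : nat) := ((fun x => (g x * phi x)%:E) \_ (I k)).
have mgphi : measurable_fun setT (fun x => (g x * phi x)%:E).
  by apply/measurable_EFinP; exact: continuous_measurable_fun.
have ig : mu.-integrable setT (fun x => (c * ((1 + x ^+ 2) * phi x))%:E).
  exact: (integrableZl measurableT c integrable_quadratic_pdf).
have gphi_le x : `|g x * phi x| <= c * ((1 + x ^+ 2) * phi x).
  rewrite normrM [`|phi x|]ger0_norm ?normal_pdf_ge0// mulrA ler_wpM2r ?normal_pdf_ge0//.
  exact: gle.
have [| | | | |_ _ cvgh] := @dominated_convergence _ _ _ mu setT measurableT h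
    (fun x => (g x * phi x)%:E) (fun x => (c * ((1 + x ^+ 2) * phi x))%:E).
- move=> k; apply/(measurable_restrictT _ _).1; first exact: measurable_itv.
  exact: measurable_funTS.
- exact: mgphi.
- apply: aeW => x _; apply: cvg_near_cst.
  near=> k; rewrite /h patchE mem_set//= /I /= in_itv /= -ler_norml.
  near: k; exists (Num.trunc `|x|) => // k /= xk.
  apply/ltW; apply: lt_le_trans (truncnS_gt _) _.
  by rewrite ler_nat ltnS.
- exact: ig.
- apply: aeW => x k _; rewrite /h patchE; case: ifP => _.
    by rewrite lee_fin.
  by rewrite abse0 lee_fin; apply: le_trans (gphi_le x).
have FTC k : (\int[mu]_x h k x = (F k.+1%:R)%:E - (F (- k.+1%:R))%:E)%E.
  rewrite /h -integral_mkcond; apply: continuous_FTC2.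
  - by rewrite -subr_gt0 opprK addr_gt0.
  - exact: continuous_subspaceT.
  - split=> [x _||]; first by case: (dF x).
      exact/cvg_at_right_filter/cF.
    exact/cvg_at_left_filter/cF.
  - by move=> x _; rewrite derive1E; case: (dF x).
(* Decay of order 1/x is enough: x <= 1 + x^2/4 <= exp(x^2/4), the first inequality being (x - 2)^2
   >= 0. *)
have F_le (x : R) : 0 < x -> `|F x| <= c * (4 * normal_peak 1) * x^-1 /\ 
                          `|F (- x)| <= c * (4 * normal_peak 1) * x^-1.
  suff H (y : R) : 0 < x -> `|y| = x -> `|F y| <= c * (4 * normal_peak 1) * x^-1.
    by move=> x0; split; apply: H; rewrite ?normrN// gtr0_norm.
  move=> x0 yx; have c0 : 0 <= c.
    by have := le_trans (normr_ge0 _) (fle 0); rewrite expr0n addr0 mulr1.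
  have Fy : `|F y| <= c * ((1 + y ^+ 2) * phi y).
    by rewrite normrN normrM [`|phi y|]ger0_norm ?normal_pdf_ge0// mulrA ler_wpM2r ?normal_pdf_ge0.
  apply: le_trans Fy _; rewrite -mulrA ler_wpM2l//.
  apply: le_trans (quadratic_pdf_le y) _; rewrite ler_wpM2l ?mulr_ge0 ?normal_peak_ge0//.
  rewrite expRN lef_pV2 ?posrE ?expR_gt0// -[y ^+ 2]real_normK ?num_real// yx.
  apply: le_trans (expR_ge1Dx _).
  by have := sqr_ge0 (x - 2); rewrite sqrrB; lra.
have cvg0 : (fun k => \int[mu]_x h k x)%E @ \oo --> 0%E.
  rewrite (_ : (fun _ => _) = EFin \o (fun k => F k.+1%:R - F (- k.+1%:R))); last first.
    by apply/funext => k; rewrite FTC.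
  apply: cvg_EFin; first exact: nearW.
  pose C := c * (4 * normal_peak 1) * 2.
  have hC : (fun k => C * harmonic k) @ \oo --> (0 : R).
    by rewrite -[X in _ --> X](mulr0 C); apply: cvgM; [exact: cvg_cst|exact: cvg_harmonic].
  apply: (@squeeze_cvgr _ _ _ _ (fun k => - (C * harmonic k)) (fun k => C * harmonic k)) => //.
    apply: nearW => k; rewrite -ler_norml; apply: le_trans (ler_normB _ _) _.
    have [h1 h2] := F_le k.+1%:R (ltr0Sn _ _).
    by apply: le_trans (lerD h1 h2) _; rewrite /C /harmonic /= [leRHS]mulrAC [leRHS]mulrDr !mulr1.
  by rewrite -[X in _ --> X]oppr0; exact: cvgN.
exact: (cvg_unique _ cvgh cvg0).
Unshelve. all: by end_near.
Qed.
End StandardNormal.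

(** * Independence and integration with one variable frozen *)

Section FreezingLemma.
Variables (d d' : measure_display) (T : measurableType d) (E : measurableType d').
Variables (R : realType) (P : probability T R) (mu : probability (measurableTypeR R) R).
Variables (x : {RV P >-> R}) (Z : {RV P >-> E}).

(** For fixed B both sides are finite measures in C that agree on a generating pi-system containing
    the whole space. *)
Lemma independent_of_pi_system (G : set (set E)) :
  d'.-measurable = <<s G >> -> setI_closed G -> G setT ->
  (forall B C, measurable B -> G C ->
     P (x @^-1` B `&` Z @^-1` C) = mu B * P (Z @^-1` C))%E ->
  forall B C, measurable B -> measurable C ->
     P (x @^-1` B `&` Z @^-1` C) = (mu B * P (Z @^-1` C))%E.
Proof.
move=> mG GI GT xZ B C mB mC.
have mxB : measurable (x @^-1` B) by exact: measurable_funPTI.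
have muB : mu B \is a fin_num by rewrite fin_num_measure.
have muB0 : 0 <= fine (mu B) by rewrite fine_ge0.
have mZ : measurable_fun setT Z by exact: measurable_funP.
pose m1 : {measure set E -> \bar R} :=
  measure_function_pushforward__canonical__measure_function_Measure (mrestr P mxB) mZ.
pose m2 := mscale (NngNum muB0) (distribution P Z).
have m1E A : m1 A = P (x @^-1` B `&` Z @^-1` A) by rewrite setIC.
have m2E A : m2 A = (mu B * P (Z @^-1` A))%E by rewrite /m2 /mscale /= fineK.
have m1m2 A : G A -> m1 A = m2 A by move=> GA; rewrite m1E m2E xZ.
rewrite -m1E -m2E; apply: (measure_unique G (fun _ => setT)) => //.
- by rewrite bigcup_const//; exists 0%N.
- move=> _; rewrite m1E preimage_setT setIT.
  by apply: le_lt_trans (probability_le1 _ mxB) _; exact: ltry.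
Qed.

(** Independence makes the law of (x, Z) a product measure, so Fubini allows integrating over x
    first with Z fixed, which gives 0. *)
Lemma expectation_freeze (h : R * E -> R) :
  (forall B, measurable B -> P (x @^-1` B) = mu B) ->
  (forall B C, measurable B -> measurable C ->
     P (x @^-1` B `&` Z @^-1` C) = (mu B * P (Z @^-1` C))%E) ->
  measurable_fun setT h ->
  P.-integrable setT (fun w => (h (x w, Z w))%:E) ->
  (forall z, \int[mu]_t (h (t, z))%:E = 0)%E ->
  (\int[P]_w (h (x w, Z w))%:E = 0)%E.
Proof.
move=> lawx ind mh ih h0.
have mW : measurable_fun setT (fun w => (x w : measurableTypeR R, Z w)).
  by apply: measurable_fun_pair; [exact: (measurable_funP x)|exact: (measurable_funP Z)].
pose W : {mfun T >-> (measurableTypeR R * E)%type} := mfun_Sub (mem_set mW).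
pose m' := pushforward P W.
have prodE : forall A, measurable A -> (mu \x distribution P Z)%E A = m' A.
  apply: product_measure_unique => B C mB mC.
  by rewrite /m' /pushforward /distribution -ind.
have mEh : measurable_fun setT (fun z : measurableTypeR R * E => (h z)%:E).
  exact/measurable_EFinP.
have im' : m'.-integrable setT (fun z => (h z)%:E).
  by apply: integrable_pushforward.
have iprod : (mu \x distribution P Z)%E.-integrable setT (fun z => (h z)%:E).
  have /integrableP[m_ lt_] := im'; apply/integrableP; split=> //.
  by rewrite (@eq_measure_integral _ _ _ _ m')// => A mA _; exact: prodE.
transitivity (\int[m']_z (h z)%:E)%E.
  by rewrite /m' integral_pushforward// preimage_setT.
transitivity (\int[(mu \x distribution P Z)%E]_z (h z)%:E)%E.
  by apply: eq_measure_integral => A mA _; exact/esym/prodE.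
rewrite -integral21_prod_meas1//=.
rewrite /fubini_G; under eq_integral do rewrite h0.
by rewrite integral0.
Qed.

End FreezingLemma.

(** * The sigma-algebra on matrices generated by rectangles *)

Section MatrixRectangles.
Variables (R : realType) (n l : nat).

Definition mx_rect (B : 'I_n -> 'I_l -> set R) : set 'M[R]_(n, l) :=
  [set M | forall a b, B a b (M a b)].

(** A generating pi-system on which mutual independence of the entries reads directly as a product
    formula. *)
Definition mx_rects : set (set 'M[R]_(n, l)) :=
  [set mx_rect B | B in [set B | forall a b, measurable (B a b)]].

Local Notation MX := (g_sigma_algebraType mx_rects).

Lemma mx_rects_setI : setI_closed mx_rects.
Proof.
move=> _ _ [B mB <-] [C mC <-]; exists (fun a b => B a b `&` C a b).
  by move=> a b; exact: measurableI.
by apply/seteqP; split=> [M h|M [h1 h2] a b] //; split=> a b; have [] := h a b.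
Qed.

Lemma mx_rects_setT : mx_rects setT.
Proof. by exists (fun _ _ => setT) => //; apply/seteqP; split. Qed.

Lemma measurable_mx_entry a b : measurable_fun setT (fun M : MX => M a b).
Proof.
move=> _ B mB; rewrite setTI; apply: sub_sigma_algebra.
exists (fun a' b' => if (a' == a) && (b' == b) then B else setT).
  by move=> a' b'; case: ifP.
apply/seteqP; split=> [M /(_ a b)|M h a' b']; first by rewrite !eqxx.
by case: ifP => // /andP[/eqP-> /eqP->].
Qed.

Lemma measurable_to_mx d (T : measurableType d) (f : T -> MX) :
  (forall a b, measurable_fun setT (fun w => f w a b)) -> measurable_fun setT f.
Proof.
move=> mf; apply: (@measurability _ _ T MX setT f mx_rects) => // _ [_ [B mB <-] <-].
rewrite setTI; have -> : f @^-1` mx_rect B =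
    \bigcap_(ab in [set: 'I_n * 'I_l]) ((fun w => f w ab.1 ab.2) @^-1` B ab.1 ab.2).
  by apply/seteqP; split=> [w h [a b] _|w h a b]; [exact: h|exact: (h (a, b))].
apply: fin_bigcap_measurable; first exact: finite_finset.
by move=> [a b] _; rewrite -[X in measurable X]setTI; exact: mf.
Qed.

End MatrixRectangles.

Lemma ge0_integral_law d d' (T : measurableType d) (E : measurableType d') (R : realType)
    (P : probability T R) (mu : probability E R) (Y : T -> E) (f : E -> \bar R) :
  measurable_fun setT Y -> (forall B, measurable B -> P (Y @^-1` B) = mu B) ->
  measurable_fun setT f -> (forall y, 0 <= f y)%E ->
  (\int[P]_w f (Y w) = \int[mu]_y f y)%E.
Proof.
move=> mY lawY mf f0; pose Ym : {RV P >-> E} := mfun_Sub (mem_set mY).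
rewrite -(ge0_integral_distribution Ym)//.
by apply: eq_measure_integral => A mA _; exact: lawY.
Qed.

(** * Integration by parts in a single matrix entry *)

Section GaussianMatrix.
Variables (d : measure_display) (T : measurableType d) (R : realType).
Variables (P : probability T R) (n l : nat) (X : 'I_n -> 'I_l -> {RV P >-> R}).
Hypothesis hX : std_gaussian_entries X.
Local Notation Om := (random_mx X).
Local Notation MX := (g_sigma_algebraType (@mx_rects R n l)).

Lemma measurable_random_mx : mx_in (fun f : T -> R => measurable_fun setT f) Om.
Proof. by move=> i j; under eq_fun do rewrite mxE; exact: measurable_funP. Qed.

Lemma integrable_fro2_random_mx : P.-integrable setT (fun w => (1 + fro2 (Om w))%:E).
Proof.
have hi i j : P.-integrable setT (fun w => (X i j w ^+ 2)%:E).
  have h := integrable_std_normal_sqr R.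
  apply/integrableP; split.
    by apply/measurable_EFinP; apply: measurable_funX; exact: measurable_funP.
  have -> : (\int[P]_w `|(X i j w ^+ 2)%:E|)%E = (\int[normal_prob 0 1]_t (t ^+ 2)%:E)%E.
    transitivity (\int[P]_w (X i j w ^+ 2)%:E)%E.
      by apply: eq_integral => w _; rewrite /= ger0_norm ?sqr_ge0.
    apply: (@ge0_integral_law _ _ T (measurableTypeR R) R P (normal_prob 0 1) (X i j)
              (fun t : R => (t ^+ 2)%:E)).
    - exact: (measurable_funP (X i j)).
    - exact: hX.1.
    - by apply/measurable_EFinP; exact: measurable_funX.
    - by move=> y; rewrite lee_fin sqr_ge0.
  have /integrableP[_] := h; apply: le_lt_trans; apply: ge0_le_integral => //=.
  - by move=> t _; rewrite lee_fin sqr_ge0.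
  - by apply/measurable_EFinP; apply: measurable_funX.
  - by apply/measurable_EFinP; apply: measurableT_comp => //; apply: measurable_funD.
  - by move=> t _; rewrite lee_fin; apply: le_trans (ler_norm _); rewrite lerDr.
have -> : (fun w => (1 + fro2 (Om w))%:E) =
    (fun w => 1%:E + \sum_(i < n) \sum_(j < l) (X i j w ^+ 2)%:E)%E.
  apply/funext => w; rewrite EFinD /fro2 mxdotE; congr (_ + _)%E.
  rewrite -sumEFin; apply: eq_bigr => i _; rewrite -sumEFin; apply: eq_bigr => j _.
  by rewrite !mxE expr2.
apply: integrableD => //.
  by apply: finite_measure_integrable_cst.
apply: integrable_sum => // i _.
by apply: integrable_sum => // j _; exact: hi.
Qed.

(* [Om = Z i j + X i j *: delta_mx i j] with [X i j] independent of [Z i j]. *)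
Let Z i j (w : T) : MX := Om w - X i j w *: delta_mx i j.

Let ZE i j w a b : Z i j w a b = if (a == i) && (b == j) then 0 else X a b w.
Proof.
rewrite !mxE; case: ifP => [/andP[/eqP-> /eqP->]|]; first by rewrite mulr1 subrr.
by rewrite mulr0 subr0.
Qed.

Let mZ i j : measurable_fun setT (Z i j).
Proof.
apply: measurable_to_mx => a b; under eq_fun do rewrite ZE.
by case: (_ && _); [exact: measurable_cst|exact: (measurable_funP (X a b))].
Qed.

(** Entry (i, j) of Z is the constant 0, so a rectangle either has empty preimage or constrains only
    the other entries, and mutual independence factors the probability. The case of the event [setT]
    for X i j identifies the remaining product with the probability that Z lies in C. *)
Let entry_independent i j (B : set R) (C : set 'M[R]_(n, l)) :
  measurable B -> mx_rects C ->
  (P (X i j @^-1` B `&` Z i j @^-1` C) = normal_prob 0 1 B * P (Z i j @^-1` C))%E.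
Proof.
move=> mB [D mD <-].
have [D0|D0] := pselect (D i j 0); last first.
  have -> : Z i j @^-1` mx_rect D = set0.
    by apply/seteqP; split=> // w /(_ i j); rewrite ZE !eqxx.
  by rewrite setI0 measure0 mule0.
pose D' (A : set R) (ab : 'I_n * 'I_l) := if ab == (i, j) then A else D ab.1 ab.2.
have mD' A : measurable A -> forall ab, measurable (D' A ab).
  by move=> mA ab; rewrite /D'; case: ifP.
have E A : X i j @^-1` A `&` Z i j @^-1` mx_rect D =
    \bigcap_(ab in [set` [set: 'I_n * 'I_l]%SET]) (X ab.1 ab.2 @^-1` D' A ab).
  apply/seteqP; split=> [w [wA wD] [a b] _|w h].
    rewrite /D' /preimage /=; case: eqP => [[-> ->]//|ne].
    by have := wD a b; rewrite ZE; case: ifP => // /andP[/eqP ai /eqP bj]; case: ne; rewrite ai bj.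
  split; first by have := h (i, j); rewrite /= /D' /preimage /= eqxx inE => /(_ isT).
  move=> a b; rewrite ZE; case: ifP => [/andP[/eqP-> /eqP->]//|ne].
  by have := h (a, b); rewrite /= /D' /preimage /= inE xpair_eqE ne => /(_ isT).
have PE A : measurable A -> (P (X i j @^-1` A `&` Z i j @^-1` mx_rect D) =
    normal_prob 0 1 A * \prod_(ab | ab != (i, j)) P (X ab.1 ab.2 @^-1` D ab.1 ab.2))%E.
  move=> mA; rewrite E (hX.2 _ _ (mD' A mA)) (bigD1 (i, j)) ?inE//=.
  rewrite {1}/D' eqxx -(hX.1 i j A mA); congr (_ * _)%E.
  by apply: eq_big => [ab|ab /andP[_ /negbTE abij]]; rewrite ?inE// /D' abij.
rewrite PE// -[Z i j @^-1` _]setTI -(preimage_setT (X i j)) PE//.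
rewrite (_ : normal_prob 0 1 setT = 1%E) ?mul1e//.
exact: (@probability_setT _ _ _ (normal_prob 0 (1 : R))).
Qed.

(** The scalar identity is applied along M + t [delta_mx i j] with the other entries frozen.
    Measurability is asked for all substitutions f because F and dF are composed both with the
    random matrix and with (t, M) |-> M + t [delta_mx i j] on a product space. *)
Lemma gaussian_matrix_ibp i j (F dF : 'M[R]_(n, l) -> R) (c : R) :
  (forall M (t : R), is_derive t 1 (fun s => F (M + s *: delta_mx i j))
                                   (dF (M + t *: delta_mx i j))) ->
  (forall M, continuous (fun s : R => dF (M + s *: delta_mx i j))) ->
  (forall d (S : measurableType d) (f : S -> 'M[R]_(n, l)),
     mx_in (fun g : S -> R => measurable_fun setT g) f ->
     measurable_fun setT (F \o f) /\ measurable_fun setT (dF \o f)) ->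
  (forall M, `|F M| <= c * (1 + fro2 M)) ->
  (forall M : 'M[R]_(n, l), `|M i j * F M - dF M| <= c * (1 + fro2 M)) ->
  P.-integrable setT (fun w => (X i j w * F (Om w) - dF (Om w))%:E) /\
  (\int[P]_w (X i j w * F (Om w) - dF (Om w))%:E = 0)%E.
Proof.
move=> hF cdF mF bF bh.
pose h (z : R * MX) : R := z.1 * F (z.2 + z.1 *: delta_mx i j) - dF (z.2 + z.1 *: delta_mx i j).
pose Zm : {RV P >-> MX} := mfun_Sub (mem_set (mZ i j)).
have OmE w : Z i j w + X i j w *: delta_mx i j = Om w by rewrite /Z subrK.
have hE w : X i j w * F (Om w) - dF (Om w) = h (X i j w, Z i j w) by rewrite /h /= OmE.
have [mF1 mdF1] := mF _ _ _ measurable_random_mx.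
have c0 : 0 <= c.
  have := le_trans (normr_ge0 _) (bF 0); have := fro2_ge0 (0 : 'M[R]_(n, l)).
  by move=> f0; rewrite pmulr_lge0// ltr_pwDl.
have ih : P.-integrable setT (fun w => (X i j w * F (Om w) - dF (Om w))%:E).
  have ig := integrableZl measurableT c integrable_fro2_random_mx.
  apply: le_integrable ig => //.
    apply/measurable_EFinP; apply: measurable_funB => //.
    by apply: measurable_funM => //; exact: (measurable_funP (X i j)).
  move=> w _; rewrite /= lee_fin; apply: le_trans (ler_norm _).
  by have := bh (Om w); rewrite mxE.
split=> //; under eq_integral do rewrite hE.
apply: (@expectation_freeze _ _ _ _ _ P (normal_prob 0 1) (X i j) Zm h).
- by move=> B mB; exact: (hX.1 i j B mB).
- apply: (@independent_of_pi_system _ _ T MX R P (normal_prob 0 1) (X i j) Zm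
            (@mx_rects R n l)) => //.
  + exact: mx_rects_setI.
  + exact: mx_rects_setT.
  + by move=> B C mB GC; exact: entry_independent.
- have mf : mx_in (fun g : measurableTypeR R * MX -> R => measurable_fun setT g)
      (fun z => z.2 + z.1 *: delta_mx i j).
    move=> a b; under eq_fun do rewrite !mxE.
    apply: measurable_funD; last by apply: measurable_funM => //; exact: measurable_fst.
    exact: (measurableT_comp (measurable_mx_entry a b) measurable_snd).
  have [m1 m2] := mF _ _ _ mf.
  apply: measurable_funB => //; apply: measurable_funM => //; exact: measurable_fst.
- by under eq_fun do rewrite -hE.
- move=> M; rewrite /h /=.
  have fro2_line t : 1 + fro2 (M + t *: delta_mx i j) <= 2 * (1 + fro2 M) * (1 + t ^+ 2).
    have d1 : fro2 (delta_mx i j : 'M[R]_(n, l)) = 1.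
      rewrite /fro2 /mxdot trmx_delta mul_delta_mx /mxtrace (bigD1 j)//= mxE !eqxx.
      by rewrite big1 ?addr0// => k /negbTE kj; rewrite mxE kj.
    have := fro2_ge0 (M - t *: delta_mx i j).
    rewrite /fro2 !(mxdotDl, mxdotDr, mxdotNl, mxdotNr) -!/(fro2 _) fro2Z d1 mulr1.
    have := fro2_ge0 M; have := sqr_ge0 t; move: (fro2 M) (mxdot _ _) (mxdot _ _) => f u v.
    by nra.
  apply: (gaussian_ibp (c := (1 + `|M i j|) * c * 2 * (1 + fro2 M)) (hF M) (cdF M)) => t.
    apply: le_trans (bF _) _; rewrite -!mulrA.
    apply: (@le_trans _ _ (c * (2 * ((1 + fro2 M) * (1 + t ^+ 2))))).
      by rewrite ler_wpM2l// mulrA fro2_line.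
    by rewrite ler_peMl ?lerDl// !mulr_ge0 ?addr_ge0 ?fro2_ge0 ?sqr_ge0.
  set Mt := M + t *: _.
  have -> : t * F Mt - dF Mt = (Mt i j * F Mt - dF Mt) - M i j * F Mt.
    by rewrite !mxE !eqxx mulr1; ring.
  apply: le_trans (ler_normB _ _) _; rewrite normrM.
  apply: (@le_trans _ _ ((1 + `|M i j|) * (c * (1 + fro2 Mt)))).
    by rewrite mulrDl mul1r lerD// ler_wpM2l.
  by rewrite -!mulrA ler_wpM2l ?addr_ge0// ler_wpM2l// mulrA fro2_line.
Qed.

End GaussianMatrix.

Lemma sqr_entry_le (R : realType) a b (M : 'M[R]_(a, b)) i j : M i j ^+ 2 <= fro2 M.
Proof.
rewrite /fro2 mxdotE (bigD1 i)//= (bigD1 j)//= -expr2 -addrA lerDl.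
by rewrite addr_ge0// sumr_ge0// => ? _; rewrite ?sumr_ge0// => *; rewrite -expr2 sqr_ge0.
Qed.

(** * Polynomial growth of matrix functions *)

Section Growth.
Variables (R : realType) (n l : nat).

(** Norms are squared on both sides, so k is the growth degree of f itself: degrees add under
    products, and a field of degree 1 has a quadratically bounded pairing with M, as integrability
    requires. *)
Definition mx_grows a b (k : nat) (f : 'M[R]_(n, l) -> 'M[R]_(a, b)) : Prop :=
  exists2 C, 0 <= C & forall M, fro2 (f M) <= C * (1 + fro2 M) ^+ k.

Let one_le (M : 'M[R]_(n, l)) : 1 <= 1 + fro2 M.
Proof. by rewrite lerDl fro2_ge0. Qed.

Lemma mx_grows_weaken a b k k' (f : 'M[R]_(n, l) -> 'M[R]_(a, b)) :
  (k <= k')%N -> mx_grows k f -> mx_grows k' f.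
Proof.
move=> kk [C C0 hf]; exists C => // M; apply: le_trans (hf M) _.
by rewrite ler_wpM2l// ler_weXn2l.
Qed.

Lemma mx_grows_bounded a b (f : 'M[R]_(n, l) -> 'M[R]_(a, b)) C :
  (forall M, fro2 (f M) <= C) -> mx_grows 0 f.
Proof.
move=> hf; exists C; first by apply: le_trans (hf 0); exact: fro2_ge0.
by move=> M; rewrite expr0 mulr1.
Qed.

Lemma mx_grows_cst a b (A : 'M[R]_(a, b)) : mx_grows 0 (fun _ => A).
Proof. exact: (mx_grows_bounded (C := fro2 A)). Qed.

Lemma mx_grows_id : mx_grows 1 (fun M => M).
Proof. by exists 1 => // M; rewrite expr1 mul1r lerDr. Qed.

Lemma mx_grows_mul a b c k k' (f : 'M[R]_(n, l) -> 'M[R]_(a, b)) (g : _ -> 'M[R]_(b, c)) :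
  mx_grows k f -> mx_grows k' g -> mx_grows (k + k') (fun M => f M *m g M).
Proof.
move=> [C C0 hf] [D D0 hg]; exists (C * D) => [|M]; first exact: mulr_ge0.
apply: le_trans (fro2_mul_le _ _) _; rewrite exprD mulrACA.
by apply: ler_pM; rewrite ?fro2_ge0.
Qed.

Lemma mx_grows_tr a b k (f : 'M[R]_(n, l) -> 'M[R]_(a, b)) :
  mx_grows k f -> mx_grows k (fun M => (f M)^T).
Proof. by move=> [C C0 hf]; exists C => // M; rewrite /fro2 mxdot_trmx; exact: hf. Qed.

Lemma mx_grows_opp a b k (f : 'M[R]_(n, l) -> 'M[R]_(a, b)) :
  mx_grows k f -> mx_grows k (fun M => - f M).
Proof. by move=> [C C0 hf]; exists C => // M; rewrite fro2N; exact: hf. Qed.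

Lemma mx_grows_add a b k (f g : 'M[R]_(n, l) -> 'M[R]_(a, b)) :
  mx_grows k f -> mx_grows k g -> mx_grows k (fun M => f M + g M).
Proof.
move=> [C C0 hf] [D D0 hg]; exists (2 * C + 2 * D) => [|M]; first by lra.
have := fro2_ge0 (f M - g M).
rewrite /fro2 !(mxdotDl, mxdotDr, mxdotNl, mxdotNr) (mxdotC (g M) (f M)) -!/(fro2 _).
by have := hf M; have := hg M; move: (_ ^+ k) => w; lra.
Qed.

Lemma mx_grows_entry a b k (f : 'M[R]_(n, l) -> 'M[R]_(a, b)) i j :
  mx_grows k f -> exists2 C, 0 <= C & forall M, f M i j ^+ 2 <= C * (1 + fro2 M) ^+ k.
Proof.
move=> [C C0 hf]; exists C => // M; apply: le_trans (hf M).
exact: sqr_entry_le.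
Qed.

Variables (r : nat) (V1 : 'M[R]_(n, r)) (e : R).
Hypothesis e_gt0 : 0 < e.

Lemma mx_grows_gramK : mx_grows 0 (@gramK R n r l V1 e).
Proof.
apply: (mx_grows_bounded (C := r%:R / e)) => M.
exact: le_trans (fro2_gramK_le _ e_gt0 _) (tr_gramS_le _ e_gt0 _).
Qed.

Lemma mx_grows_gramS : mx_grows 0 (@gramS R n r l V1 e).
Proof.
apply: (mx_grows_bounded (C := r%:R / e / e)) => M.
rewrite ler_pdivlMr// mulrC.
exact: le_trans (fro2_gramS_le _ e_gt0 _) (tr_gramS_le _ e_gt0 _).
Qed.

Lemma mx_grows_gramP : mx_grows 0 (@gramP R n r l V1 e).
Proof. by apply: (mx_grows_bounded (C := r%:R)) => M; exact: fro2_gramP_le. Qed.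

End Growth.

(** An impredicative form of rational dependence with nonvanishing denominators: substitution into f
    preserves every function algebra, so one closure proof yields both measurability and
    derivability along lines. *)
Definition mx_rational (R : realType) n l a b (f : 'M[R]_(n, l) -> 'M[R]_(a, b)) : Prop :=
  forall (T : Type) (Cl : (T -> R) -> Prop), fun_algebra Cl ->
  forall g : T -> 'M[R]_(n, l), mx_in Cl g -> mx_in Cl (fun t => f (g t)).

Section DivergenceSums.
Variables (R : realType) (n l : nat).

(** The divergence of the linear field M |-> A M B; the next lemma is the divergence of M |-> A M^T
    B. *)
Lemma sum_delta_mul (A : 'M[R]_n) (B : 'M[R]_l) :
  \sum_i \sum_j (A *m delta_mx i j *m B) i j = \tr A * \tr B.
Proof.
rewrite /mxtrace mulr_suml; apply: eq_bigr => i _; rewrite mulr_sumr; apply: eq_bigr => j _.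
rewrite mxE (bigD1 j)//= big1 => [|k kj].
  rewrite mxE (bigD1 i)//= big1 => [|k ki]; first by rewrite !mxE !eqxx mulr1 !addr0.
  by rewrite mxE (negbTE ki) mulr0.
by rewrite mxE big1 ?mul0r// => k' _; rewrite mxE (negbTE kj) andbF mulr0.
Qed.

Lemma sum_delta_tr_mul (A B : 'M[R]_(n, l)) :
  \sum_i \sum_j (A *m (delta_mx i j)^T *m B) i j = mxdot A B.
Proof.
rewrite mxdotE; apply: eq_bigr => i _; apply: eq_bigr => j _.
rewrite trmx_delta mxE (bigD1 i)//= big1 => [|k ki].
  rewrite mxE (bigD1 j)//= big1 => [|k kj]; first by rewrite !mxE !eqxx mulr1 !addr0.
  by rewrite mxE (negbTE kj) mulr0.
by rewrite mxE big1 ?mul0r// => k' _; rewrite mxE (negbTE ki) andbF mulr0.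
Qed.

End DivergenceSums.

Section GaussianField.
Variables (d : measure_display) (T : measurableType d) (R : realType).
Variables (P : probability T R) (n l : nat) (X : 'I_n -> 'I_l -> {RV P >-> R}).
Hypothesis hX : std_gaussian_entries X.
Local Notation Om := (random_mx X).

Definition mean_zero (h : 'M[R]_(n, l) -> R) : Prop :=
  P.-integrable setT (fun w => (h (Om w))%:E) /\ (\int[P]_w (h (Om w))%:E = 0)%E.

(** Each entry of Phi is integrated by parts along its own direction and the results are summed.
    Growth of degree 1 keeps M i j times Phi i j within the quadratic bound that is integrable. *)
Lemma gaussian_divergence (Phi : 'M[R]_(n, l) -> 'M[R]_(n, l))
    (dPhi : 'I_n -> 'I_l -> 'M[R]_(n, l) -> 'M[R]_(n, l)) :
  (forall i j M (t : R), mx_is_derive t (fun s => Phi (M + s *: delta_mx i j))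
                           (dPhi i j (M + t *: delta_mx i j))) ->
  mx_rational Phi -> (forall i j, mx_rational (dPhi i j)) ->
  mx_grows 1 Phi -> (forall i j, mx_grows 1 (dPhi i j)) ->
  mean_zero (fun M => mxdot M (Phi M) - \sum_i \sum_j dPhi i j M i j).
Proof.
move=> hd rPhi rdPhi gPhi gdPhi.
have H i j : mean_zero (fun M => M i j * Phi M i j - dPhi i j M i j).
  have [C C0 hC] := mx_grows_entry i j gPhi.
  have [D D0 hD] := mx_grows_entry i j (gdPhi i j).
  have one_le (M : 'M[R]_(n, l)) : 1 <= 1 + fro2 M by rewrite lerDl fro2_ge0.
  have sqr_bound (c x y : R) : 0 <= c -> 1 <= y -> x ^+ 2 <= c * y ^+ 2 -> `|x| <= (1 + c) * y.
    move=> c0 y1 xy; have y0 : 0 <= y by exact: le_trans ler01 y1.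
    rewrite -(@ler_pXn2r _ 2) ?nnegrE ?mulr_ge0 ?addr_ge0//.
    rewrite real_normK ?num_real//; apply: le_trans xy _; rewrite exprMn ler_wpM2r ?sqr_ge0//.
    by rewrite expr2; nra.
  have [hi h0] :
      P.-integrable setT (fun w => (X i j w * Phi (Om w) i j - dPhi i j (Om w) i j)%:E) /\
      (\int[P]_w (X i j w * Phi (Om w) i j - dPhi i j (Om w) i j)%:E = 0)%E.
    apply: (gaussian_matrix_ibp hX (F := fun M => Phi M i j) (dF := fun M => dPhi i j M i j)
              (c := (1 + C) + (1 + 2 * (C + D)))).
    - by move=> M t; exact: hd.
    - move=> M t; apply: differentiable_continuous; apply/derivable1_diffP.
      apply: (rdPhi i j _ _ (derivable_fun_algebra t)) => a b.
      by case: (mx_is_derive_line t M (delta_mx i j) a b).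
    - move=> d' S f mf; split.
        exact: (rPhi _ _ (measurable_fun_algebra S R) _ mf i j).
      exact: (rdPhi i j _ _ (measurable_fun_algebra S R) _ mf i j).
    - move=> M; apply: (@le_trans _ _ ((1 + C) * (1 + fro2 M))).
        apply: sqr_bound => //; apply: le_trans (hC M) _.
        by rewrite ler_wpM2l// ler_weXn2l.
      by rewrite ler_wpM2r ?(le_trans ler01)// lerDl; lra.
    - move=> M; apply: (@le_trans _ _ ((1 + 2 * (C + D)) * (1 + fro2 M))).
        apply: sqr_bound => //; first by lra.
        have Mij : M i j ^+ 2 <= 1 + fro2 M.
          by apply: le_trans (sqr_entry_le M i j) _; rewrite lerDr.
        have h1 : (M i j * Phi M i j) ^+ 2 <= C * (1 + fro2 M) ^+ 2.
          rewrite exprMn [(1 + fro2 M) ^+ 2]expr2 [leRHS]mulrCA.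
          by apply: ler_pM; rewrite ?sqr_ge0//.
        have h2 : (dPhi i j M i j) ^+ 2 <= D * (1 + fro2 M) ^+ 2.
          by apply: le_trans (hD M) _; rewrite ler_wpM2l// ler_weXn2l.
        move: h1 h2; move: (_ * Phi M i j) (dPhi i j M i j) ((1 + fro2 M) ^+ 2) => u v w h1 h2.
        by have := sqr_ge0 (u + v); rewrite [(u - v) ^+ 2]sqrrB [(u + v) ^+ 2]sqrrD; lra.
      by rewrite ler_wpM2r ?(le_trans ler01)// lerDr; lra.
  have E w : X i j w = Om w i j by rewrite mxE.
  by split; [move: hi|move: h0]; under eq_fun do rewrite E.
have hE M : mxdot M (Phi M) - \sum_i \sum_j dPhi i j M i j =
    \sum_i \sum_j (M i j * Phi M i j - dPhi i j M i j).
  rewrite mxdotE -sumrB; apply: eq_bigr => i _; rewrite -sumrB.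
  by apply: eq_bigr => j _.
have ih i j := (H i j).1.
have hEE : (fun w => (mxdot (Om w) (Phi (Om w)) - \sum_i \sum_j dPhi i j (Om w) i j)%:E) =
    (fun w => \sum_i \sum_j (Om w i j * Phi (Om w) i j - dPhi i j (Om w) i j)%:E)%E.
  apply/funext => w; rewrite hE -sumEFin; apply: eq_bigr => i _.
  by rewrite -sumEFin.
have ihi i : P.-integrable setT
    (fun w => \sum_j (Om w i j * Phi (Om w) i j - dPhi i j (Om w) i j)%:E)%E.
  by apply: integrable_sum => // j _; exact: ih.
split; rewrite hEE.
  by apply: integrable_sum => // i _; exact: ihi.
rewrite integral_sum//.
rewrite big1// => i _; rewrite integral_sum//.
by rewrite big1// => j _; exact: (H i j).2.
Qed.
End GaussianField.

(** * Mean-zero identities for the regularized inverse *)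

Lemma trmxB (R : zmodType) a b (A B : 'M[R]_(a, b)) : (A - B)^T = A^T - B^T.
Proof. by apply/matrixP => i j; rewrite !mxE. Qed.

Section InverseWishart.
Variables (d : measure_display) (T : measurableType d) (R : realType).
Variables (P : probability T R) (n l : nat) (X : 'I_n -> 'I_l -> {RV P >-> R}).
Hypothesis hX : std_gaussian_entries X.
Variables (r : nat) (V1 : 'M[R]_(n, r)) (e : R).
Hypotheses (e_gt0 : 0 < e) (V1_orth : V1^T *m V1 = 1%:M).

Local Notation S := (@gramS R n r l V1 e).
Local Notation K := (@gramK R n r l V1 e).
Local Notation Pr := (@gramP R n r l V1 e).

Let dK (i : 'I_n) (j : 'I_l) (M : 'M[R]_(n, l)) : 'M[R]_(l, r) :=
  (1%:M - Pr M) *m (V1^T *m delta_mx i j)^T *m S M - K M *m (V1^T *m delta_mx i j) *m K M.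

Let dK_derive i j M (t : R) :
  mx_is_derive t (fun s => K (M + s *: delta_mx i j)) (dK i j (M + t *: delta_mx i j)).
Proof. exact: mx_is_derive_gramK. Qed.

Let rational_K : mx_rational K.
Proof. by move=> T' Cl fa f hf; exact: mx_in_gramK. Qed.

Let rational_dK i j : mx_rational (dK i j).
Proof.
move=> T' Cl fa f hf; have cst := mx_in_cst fa.
apply: (mx_in_add fa).
  apply: (mx_in_mul fa); last exact: mx_in_gramS.
  apply: (mx_in_mul fa); last exact: cst.
  apply: (mx_in_add fa); first exact: cst.
  under eq_fun do rewrite -scaleN1r.
  by apply: (mx_in_scale fa); exact: mx_in_gramP.
under eq_fun do rewrite -scaleN1r.
apply: (mx_in_scale fa); apply: (mx_in_mul fa); last exact: mx_in_gramK.
by apply: (mx_in_mul fa); [exact: mx_in_gramK|exact: cst].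
Qed.

Let grows_K := @mx_grows_gramK R n l r V1 e e_gt0.

Let grows_dK i j : mx_grows 0 (dK i j).
Proof.
have cst := @mx_grows_cst R n l.
apply: mx_grows_add; last apply: mx_grows_opp.
  apply: (mx_grows_mul (k := 0) (k' := 0)); last exact: mx_grows_gramS.
  apply: (mx_grows_mul (k := 0) (k' := 0)); last exact: cst.
  by apply: mx_grows_add; [exact: cst|apply: mx_grows_opp; exact: mx_grows_gramP].
apply: (mx_grows_mul (k := 0) (k' := 0)); last exact: grows_K.
by apply: (mx_grows_mul (k := 0) (k' := 0)); [exact: grows_K|exact: cst].
Qed.

Let dK_tr i j M : (dK i j M)^T = S M *m V1^T *m delta_mx i j *m (1%:M - Pr M)
                        - (K M)^T *m (delta_mx i j)^T *m (V1 *m (K M)^T).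
Proof.
rewrite /dK trmxB !trmx_mul !trmxK gramS_sym// trmxB trmx1 gramP_sym//.
by rewrite !mulmxA.
Qed.

(* Integration by parts for [M |-> V1 K^T], whose divergence is the subtracted term. *)
Lemma trace_gramS_mean_zero :
  mean_zero X (fun M => \tr (Pr M) - (\tr (S M) * (l%:R - \tr (Pr M)) - fro2 (K M))).
Proof.
pose Phi (M : 'M[R]_(n, l)) := V1 *m (K M)^T.
pose dPhi i j (M : 'M[R]_(n, l)) := V1 *m (dK i j M)^T.
have := gaussian_divergence hX (Phi := Phi) (dPhi := dPhi).
have hE M : mxdot M (Phi M) - \sum_i \sum_j dPhi i j M i j =
   \tr (Pr M) - (\tr (S M) * (l%:R - \tr (Pr M)) - fro2 (K M)).
  congr (_ - _).
    rewrite mxdotC /Phi mxdot_mull /mxdot trmxK -[RHS]mxtrace_tr.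
    by rewrite -(gramP_sym V1 e_gt0) trmxK.
  (* The two parts of dK^T contribute tr(V1 S V1^T) tr(I - P) and <V1 K^T, V1 K^T>; orthonormality
     of V1 reduces them to tr S (l - tr P) and |K|_F^2. *)
  under eq_bigr => i _.
    under eq_bigr => j _.
      rewrite /dPhi dK_tr mulmxBr !mulmxA mxE [X in _ + X]mxE.
      over.
    rewrite big_split /= sumrN.
    over.
  rewrite big_split /= sumrN sum_delta_mul; congr (_ - _).
    rewrite linearB /= mxtrace1; congr (_ * _).
    by rewrite mxtrace_mulC mulmxA V1_orth mul1mx.
  under eq_bigr do under eq_bigr do rewrite -mulmxA.
  rewrite sum_delta_tr_mul mxdot_mull mulmxA V1_orth mul1mx.
  by rewrite mxdot_trmx.
under eq_fun do rewrite hE.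
apply.
- move=> i j M t; rewrite -[dPhi _ _ _]add0r -[X in X + _](mul0mx _ (K (M + t *: delta_mx i j))^T).
  apply: mx_is_derive_mul; first exact: mx_is_derive_cst.
  exact/mx_is_derive_tr/dK_derive.
- move=> T' Cl fa f hf; apply: (mx_in_mul fa); first exact: mx_in_cst.
  by apply: mx_in_tr; exact: rational_K.
- move=> i j T' Cl fa f hf; apply: (mx_in_mul fa); first exact: mx_in_cst.
  by apply: mx_in_tr; exact: rational_dK.
- apply: (mx_grows_weaken (k := 0)) => //.
  apply: (mx_grows_mul (k := 0) (k' := 0)); first exact: mx_grows_cst.
  exact/mx_grows_tr/grows_K.
- move=> i j; apply: (mx_grows_weaken (k := 0)) => //.
  apply: (mx_grows_mul (k := 0) (k' := 0)); first exact: mx_grows_cst.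
  exact/mx_grows_tr/grows_dK.
Qed.

Variables (m : nat) (B : 'M[R]_(m, n)).
Hypothesis BV1 : B *m V1 = 0.
Let C := B^T *m B.

Let V1C : V1^T *m C = 0.
Proof. by rewrite /C mulmxA -trmx_mul BV1 trmx0 mul0mx. Qed.

(* The derivative of [K] only sees [V1^T M], on which [B M] does not depend:
   it contributes nothing to the divergence of [M |-> B^T B M K K^T]. *)
Lemma fro2_BMK_mean_zero :
  mean_zero X (fun M => fro2 (B *m M *m K M) - fro2 B * fro2 (K M)).
Proof.
pose Phi (M : 'M[R]_(n, l)) := C *m M *m (K M *m (K M)^T).
pose dPhi i j (M : 'M[R]_(n, l)) := C *m delta_mx i j *m (K M *m (K M)^T)
   + C *m M *m (dK i j M *m (K M)^T + K M *m (dK i j M)^T).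
have := gaussian_divergence hX (Phi := Phi) (dPhi := dPhi).
have hE M : mxdot M (Phi M) - \sum_i \sum_j dPhi i j M i j =
   fro2 (B *m M *m K M) - fro2 B * fro2 (K M).
  congr (_ - _).
    have -> : Phi M = B^T *m (B *m M *m K M *m (K M)^T) by rewrite /Phi /C !mulmxA.
    by rewrite -mxdot_mull -mxdot_mulr.
  (* Each of the four terms coming from dK carries either a trace of C A V1^T or a pairing of C A
     with V1 A'; both vanish since V1^T C = 0. *)
  have tr0 A : \tr (C *m A *m V1^T) = 0.
    by rewrite mxtrace_mulC mulmxA V1C mul0mx mxtrace0.
  have dot0 a (A : 'M[R]_(n, a)) A' : mxdot (C *m A) (V1 *m A') = 0.
    by rewrite mxdotC mxdot_mull mulmxA V1C mul0mx /mxdot mulmx0 mxtrace0.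
  have entryE i j : dPhi i j M i j =
      (C *m delta_mx i j *m (K M *m (K M)^T)) i j
      + ((C *m (M *m (1%:M - Pr M)) *m (delta_mx i j)^T *m (V1 *m (S M *m (K M)^T))) i j
      - (C *m (M *m K M) *m V1^T *m delta_mx i j *m (K M *m (K M)^T)) i j
      + ((C *m (M *m K M *m S M) *m V1^T *m delta_mx i j *m (1%:M - Pr M)) i j
      - (C *m (M *m K M *m (K M)^T) *m (delta_mx i j)^T *m (V1 *m (K M)^T)) i j)).
    have mxeq A1 A2 A3 A4 A5 : (A1 + (A2 - A3 + (A4 - A5)) : 'M[R]_(n, l)) i j =
        A1 i j + (A2 i j - A3 i j + (A4 i j - A5 i j)) by rewrite !mxE.
    rewrite -mxeq; congr (fun_of_matrix _ i j); rewrite /dPhi; congr (_ + _).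
    rewrite dK_tr /dK; move: (1%:M - Pr M) => N.
    rewrite mulmxDr mulmxBl !mulmxBr trmx_mul trmxK.
    by congr (_ - _ + (_ - _)); rewrite !mulmxA.
  under eq_bigr do under eq_bigr do rewrite entryE.
  under eq_bigr do rewrite !(big_split, sumrN) /=.
  rewrite !(big_split, sumrN) /= !sum_delta_mul !sum_delta_tr_mul !tr0 !dot0.
  rewrite !mul0r !subr0 !addr0 -[fro2 B]/(\tr C); congr (_ * _).
  by rewrite mxtrace_mulC.
under eq_fun do rewrite hE.
have cst T' (Cl : (T' -> R) -> Prop) (fa : fun_algebra Cl) := @mx_in_cst _ _ _ fa.
have rKK : mx_rational (fun M => K M *m (K M)^T).
  move=> T' Cl fa f hf; have h := rational_K fa hf.
  by apply: (mx_in_mul fa) => //; exact: mx_in_tr.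
have gcst := @mx_grows_cst R n l.
have gKK : mx_grows 0 (fun M => K M *m (K M)^T).
  by apply: (mx_grows_mul (k := 0) (k' := 0)); [exact: grows_K|exact/mx_grows_tr/grows_K].
have gCM : mx_grows 1 (fun M : 'M[R]_(n, l) => C *m M).
  by apply: (mx_grows_mul (k := 0) (k' := 1)); [exact: gcst|exact: mx_grows_id].
apply.
- move=> i j M t.
  have hC : mx_is_derive t (fun s => C *m (M + s *: delta_mx i j)) (C *m delta_mx i j).
    have := mx_is_derive_mul (mx_is_derive_cst t C) (mx_is_derive_line t M (delta_mx i j)).
    by rewrite mul0mx add0r.
  have hK := dK_derive i j M t.
  exact: mx_is_derive_mul hC (mx_is_derive_mul hK (mx_is_derive_tr hK)).
- move=> T' Cl fa f hf; apply: (mx_in_mul fa); last exact: (rKK _ _ fa).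
  by apply: (mx_in_mul fa) => //; exact: cst.
- move=> i j T' Cl fa f hf.
  have hK := rational_K fa hf; have hdK := rational_dK i j fa hf.
  apply: (mx_in_add fa).
    by apply: (mx_in_mul fa); [exact: cst|exact: (rKK _ _ fa)].
  apply: (mx_in_mul fa); first by apply: (mx_in_mul fa) => //; exact: cst.
  by apply: (mx_in_add fa); apply: (mx_in_mul fa) => //; exact: mx_in_tr.
- by apply: (mx_grows_mul (k := 1) (k' := 0)).
- move=> i j; apply: mx_grows_add.
    apply: (mx_grows_weaken (k := 0)) => //.
    by apply: (mx_grows_mul (k := 0) (k' := 0)) => //; exact: gcst.
  apply: (mx_grows_mul (k := 1) (k' := 0)) => //.
  apply: mx_grows_add; apply: (mx_grows_mul (k := 0) (k' := 0)) => //; exact: mx_grows_tr.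
Qed.

End InverseWishart.

(** * Expected projection error *)

Section ExpectedError.
Variables (d : measure_display) (T : measurableType d) (R : realType).
Variable P : probability T R.

(* The integral of a nonnegative function is a supremum over simple functions
   below it, so [f] need not be measurable (in the theorem, Q is an arbitrary
   function of Y). *)
Lemma expectation_le_of_dominated (f g : T -> R) :
  (forall w, 0 <= f w <= g w) -> ('E_P[f] <= \int[P]_w (g w)%:E)%E.
Proof.
move=> fg; rewrite unlock ge0_integralTE => [|w]; last by rewrite lee_fin; case/andP: (fg w).
rewrite ge0_integralTE => [|w]; last first.
  by rewrite lee_fin; have /andP[/le_trans] := fg w; apply.
apply: le_ereal_sup => _ [h hf <-]; exists h => // w.
by apply: le_trans (hf w) _; rewrite lee_fin; case/andP: (fg w).
Qed.

Variables (m n r p : nat) (A : 'M[R]_(m, n)) (sigma : 'I_m -> R).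
Hypotheses (rn : (r <= n)%N) (p_ge2 : (2 <= p)%N) (hA : singular_values A sigma).
Variable X : 'I_n -> 'I_(r + p) -> {RV P >-> R}.
Hypothesis hX : std_gaussian_entries X.
Local Notation Om := (random_mx X).

Lemma projection_error_bound : exists2 K : R, 0 <= K & forall e : R, 0 < e ->
  exists c : 'M[R]_(n, r + p) -> R,
    [/\ forall M, 0 <= c M,
        forall M (Q : 'M[R]_(m, minn m (r + p))) S (x : 'cV[R]_n), thin_qr (A *m M) Q S ->
          fro2 ((1%:M - Q *m Q^T) *m A *m x) <= c M * fro2 x,
        P.-integrable setT (fun w => (c (Om w))%:E)
      & (\int[P]_w (c (Om w))%:E = (Psi sigma n r p + K * e)%:E)%E].
Proof.
have [V1 [VV ort Bx fB]] := svd_split rn hA.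
set B := A *m (1%:M - V1 *m V1^T) in ort Bx fB.
have BV1 : B *m V1 = 0.
  by rewrite /B -mulmxA mulmxBl mul1mx -mulmxA VV mulmx1 subrr mulmx0.
have q0 : 0 < p%:R - 1 :> R by rewrite subr_gt0 ltr1n.
(* The coefficient of e: the defect contributes e |A V1|_F^2 tr S, and r / (p - 1) is the bound on
   the expectation of tr S. *)
exists (fro2 (A *m V1) * (r%:R / (p%:R - 1))) => [|e e0].
  by rewrite mulr_ge0 ?fro2_ge0// divr_ge0// ltW.
(* The total coefficient of tr S: one part from the regularization defect, the other from the tail
   B. *)
pose a := e * fro2 (A *m V1) + fro2 B.
have a0 : 0 <= a by rewrite addr_ge0 ?fro2_ge0// mulr_ge0 ?fro2_ge0// ltW.
have := trace_gramS_mean_zero hX e0 VV; set h1 := (h in mean_zero _ h) => -[ih1 h10].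
have := fro2_BMK_mean_zero hX e0 BV1; set h2 := (h in mean_zero _ h) => -[ih2 h20].
pose c M := lam sigma r + a * (r%:R / (p%:R - 1)) - a / (p%:R - 1) * h1 M + h2 M.
(* Here r - h1 equals (p - 1) tr S + e (tr S + (tr S)^2 + |S|_F^2), and the terms in e are
   nonnegative. *)
have trS_le M : \tr (gramS V1 e M) <= (r%:R - h1 M) / (p%:R - 1).
  rewrite ler_pdivlMr// /h1 fro2_gramK// tr_gramP//.
  have t0 := tr_gramS_ge0 V1 e0 M; have f0 := fro2_ge0 (gramS V1 e M).
  have := mulr_ge0 (ltW e0) f0; have := mulr_ge0 (ltW e0) t0.
  have := mulr_ge0 (ltW e0) (sqr_ge0 (\tr (gramS V1 e M))).
  rewrite natrD; move: (\tr _) (fro2 _) => t f; lra.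
have c_ge M : lam sigma r + (e ^+ 2 * fro2 (A *m V1 *m gramS V1 e M)
                    + fro2 (B *m M *m gramK V1 e M)) <= c M.
  have s1 : e ^+ 2 * fro2 (A *m V1 *m gramS V1 e M) <=
            e * fro2 (A *m V1) * \tr (gramS V1 e M).
    rewrite expr2 -!mulrA ler_wpM2l ?(ltW e0)//.
    apply: le_trans (ler_wpM2l (ltW e0) (fro2_mul_le _ _)) _.
    by rewrite mulrCA ler_wpM2l ?fro2_ge0// fro2_gramS_le.
  have s2 : fro2 (B *m M *m gramK V1 e M) <= h2 M + fro2 B * \tr (gramS V1 e M).
    rewrite -lerBlDl /h2 opprB addrCA subrr addr0.
    by rewrite ler_wpM2l ?fro2_ge0// fro2_gramK_le.
  have := ler_wpM2l a0 (trS_le M).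
  rewrite /c /a; move: s1 s2; lra.
have ic k : P.-integrable setT (fun _ : T => k%:E) by exact: finite_measure_integrable_cst.
have ih1' := integrableZl measurableT (- (a / (p%:R - 1))) ih1.
have cE : (fun w => (c (Om w))%:E) = (fun w => (lam sigma r + a * (r%:R / (p%:R - 1)))%:E
    + ((- (a / (p%:R - 1)))%:E * (h1 (Om w))%:E) + (h2 (Om w))%:E)%E.
  by apply/funext => w; rewrite -EFinM -!EFinD mulNr.
exists c; split=> [M|M Q S x hQ||].
- apply: le_trans (c_ge M).
  by rewrite !addr_ge0 ?lam_ge0 ?fro2_ge0// mulr_ge0 ?sqr_ge0 ?fro2_ge0.
- pose Cm := e *: (A *m V1 *m gramS V1 e M) - B *m M *m gramK V1 e M.
  have Cm_fro : fro2 Cm = e ^+ 2 * fro2 (A *m V1 *m gramS V1 e M)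
                    + fro2 (B *m M *m gramK V1 e M).
    rewrite /Cm fro2D_orth ?fro2Z ?fro2N//.
    rewrite mxdotZl mxdotNr mxdot_mull -(mulmxA B) (mulmxA _ B) ort mul0mx.
    by rewrite /mxdot mulmx0 mxtrace0 oppr0 mulr0.
  (* Splitting A M into A V1 G + B M, the identity G K = I - e S leaves e A V1 S V1^T from the
     leading part. The two pieces of [Cm] are orthogonal because (A V1)^T B = 0. *)
  have resE : A - A *m M *m (gramK V1 e M *m V1^T) = Cm *m V1^T + B.
    have -> : A *m M = A *m V1 *m (V1^T *m M) + B *m M.
      by rewrite /B mulmxBr mulmx1 mulmxBl !mulmxA addrC subrK.
    have GK := mul_gramK V1 e0 M.
    rewrite mulmxA (mulmxDl _ (B *m M)) -[A *m V1 *m _ *m _]mulmxA GK mulmxBr mulmx1 -scalemxAr.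
    rewrite /Cm; move: (e *: _) (B *m M *m _) => E F.
    have -> : B = A - A *m V1 *m V1^T by rewrite /B mulmxBr mulmx1 mulmxA.
    rewrite !mulmxDl !mulNmx; move: (A *m V1 *m V1^T) (E *m V1^T) (F *m V1^T) => U' E' F'.
    by apply/matrixP => i j; rewrite !mxE; ring.
  apply: le_trans (thin_qr_residual_le (gramK V1 e M *m V1^T) x hQ) _.
  rewrite resE; apply: le_trans (residual_le _ _ VV (lam_ge0 _ _) Bx) _.
  by rewrite ler_wpM2r ?fro2_ge0// Cm_fro.
- by rewrite cE; apply: integrableD => //; exact: integrableD.
rewrite cE integralD//; last exact: integrableD.
rewrite integralD// integralZl// h10 h20 mule0 !adde0.
have := expectation_cst P (lam sigma r + a * (r%:R / (p%:R - 1))).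
rewrite unlock => ->; congr (_%:E).
by rewrite /Psi -fB /a; ring.
Qed.
End ExpectedError.

Local Close Scope classical_set_scope.

(** * The sketched Hessian and the expected bounds *)

Section FixedSketch.
Variables (R : realType) (m n k : nat) (A : 'M[R]_(m, n)) (Q : 'M[R]_(m, k)).
Hypothesis QQ : Q^T *m Q = 1%:M.

Lemma rand_svd_sym : (rand_svd A Q)^T = rand_svd A Q.
Proof. by rewrite /rand_svd !trmx_mul !trmxK !mulmxA. Qed.

Lemma rand_svd_psd (x : 'cV[R]_n) : 0 <= mxdot x (rand_svd A Q *m x).
Proof.
have -> : rand_svd A Q *m x = A^T *m (Q *m (Q^T *m (A *m x))) by rewrite /rand_svd !mulmxA.
by rewrite -mxdot_mull mxdotC mxdot_mull fro2_ge0.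
Qed.

Lemma gram_rand_svd_split : A^T *m A =
  rand_svd A Q + ((1%:M - Q *m Q^T) *m A)^T *m ((1%:M - Q *m Q^T) *m A).
Proof.
rewrite trmx_mul trmxB trmx1 trmx_mul trmxK !mulmxA -(mulmxA A^T).
rewrite (_ : (1%:M - Q *m Q^T) *m (1%:M - Q *m Q^T) = 1%:M - Q *m Q^T).
  by rewrite mulmxBr mulmx1 mulmxBl /rand_svd !mulmxA addrC subrK.
rewrite mulmxBr mulmx1 mulmxBl mul1mx -mulmxA (mulmxA Q^T) QQ mul1mx.
by rewrite subrr subr0.
Qed.

End FixedSketch.

Theorem theorem1 (R : realType) (d : measure_display) (T : measurableType d)
    (P : probability T R) (m n r p : nat)
    (hmn : (m <= n)%N) (hr1 : (1 <= r)%N) (hrm : (r <= m)%N) (hp : (2 <= p)%N)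
    (A : 'M[R]_(m, n)) (sigma : 'I_m -> R) (hsigma : singular_values A sigma)
    (hlam : lam sigma r != 0)
    (Gamma : 'M[R]_n) (hGamma : sym_pd Gamma)
    (g : 'cV[R]_n) (hg : g != 0)
    (X : 'I_n -> 'I_(r + p) -> {RV P >-> R}) (hX : std_gaussian_entries X)
    (Qof : 'M[R]_(m, r + p) -> 'M[R]_(m, minn m (r + p)))
    (Rof : 'M[R]_(m, r + p) -> 'M[R]_(minn m (r + p), r + p))
    (hQR : forall Y, thin_qr Y (Qof Y) (Rof Y))
    (dx : 'cV[R]_n) (dxhat : T -> 'cV[R]_n) :
  let H : 'M[R]_n := A^T *m A in
  let Hhat (w : T) : 'M[R]_n := rand_svd A (Qof (A *m random_mx X w)) in
  gn_hessian Gamma H *m dx = - g ->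
  (forall w, gn_hessian Gamma (Hhat w) *m dxhat w = - g) ->
  [/\ Psi sigma n r p =
        (1 + r%:R / (p%:R - 1) * intdim sigma n r) * lam sigma r,
      ('E_P[fun w => (wnorm (invmx Gamma) (dx - dxhat w) /
                      wnorm (invmx Gamma) dx)%R] <= (Psi sigma n r p)%:E)%E
    & ('E_P[fun w => cond2 (precond H (Hhat w))]
         <= (1 + Psi sigma n r p)%R%:E)%E].
Proof.
move=> H Hhat hdx hdxhat.
have rn : (r <= n)%N by exact: leq_trans hrm hmn.
pose Q w := Qof (A *m random_mx X w).
have QQ w : (Q w)^T *m Q w = 1%:M by case: (hQR (A *m random_mx X w)).
pose D w := (1%:M - Q w *m (Q w)^T) *m A.
have HE w : H = Hhat w + (D w)^T *m D w by exact: gram_rand_svd_split (QQ w).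
have Hsym w : (Hhat w)^T = Hhat w by exact: rand_svd_sym.
have Hpsd w (x : 'cV[R]_n) : 0 <= mxdot x (Hhat w *m x) by exact: rand_svd_psd.
have [K K0 bound] := projection_error_bound rn hp hsigma hX.
have to_zero (E : \bar R) (u : R) :
    (forall e : R, 0 < e -> (E <= (u + K * e)%:E)%E) -> (E <= u%:E)%E.
  move=> h; apply/lee_addgt0Pr => e e0.
  (* Dividing e by 1 + K rather than by K covers the case K = 0. *)
  have K1 : 0 < 1 + K by rewrite ltr_pwDl.
  apply: le_trans (h (e / (1 + K)) (divr_gt0 e0 K1)) _.
  rewrite -EFinD lee_fin lerD2l mulrCA ler_piMr ?(ltW e0)//.
  by rewrite ler_pdivrMr// mul1r lerDr.
pose S := sqrtmx Gamma; have uS : S \in unitmx by exact: sqrtmx_unit.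
(* In the variable Gamma^{-1/2} y both steps solve systems I + M with the same right-hand side, and
   the weighted norm becomes Euclidean. *)
have whiten (M : 'M[R]_n) y : gn_hessian Gamma M *m y = - g ->
    (1%:M + M) *m (invmx S *m y) = - (S *m g).
  rewrite /gn_hessian -/S -!mulmxA => /(congr1 (mulmx S)).
  by rewrite mulKVmx// mulmxN.
split.
- by rewrite /Psi /intdim mulrDl mul1r -[_ * lam sigma r]mulrA divfK.
- apply: to_zero => e e0; have [c [c0 hc _ <-]] := bound e e0.
  apply: expectation_le_of_dominated => w.
  rewrite divr_ge0 ?norm2_ge0//= !wnorm_invE// -/S mulmxBr.
  have err : norm2 (invmx S *m dx - invmx S *m dxhat w)
             <= c (random_mx X w) * norm2 (invmx S *m dx).
    apply: (solution_error_le (Hpsd w) (c0 _) (D := D w) _ _ (whiten _ _ (hdxhat w))).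
      by move=> x; apply: hc (hQR _).
    by rewrite -HE; exact: whiten.
  (* A quotient by a zero norm is 0 by convention, below the nonnegative c. *)
  have [->|u0] := eqVneq (norm2 (invmx S *m dx)) 0; first by rewrite invr0 mulr0 c0.
  by rewrite ler_pdivrMr// lt_neqAle eq_sym u0 norm2_ge0.
- apply: to_zero => e e0; have [c [c0 hc ic cE]] := bound e e0.
  have -> : (1 + Psi sigma n r p + K * e)%:E = (\int[P]_w (1 + c (random_mx X w))%:E)%E.
    under eq_integral do rewrite EFinD.
    rewrite integralD//; last exact: finite_measure_integrable_cst.
    have := expectation_cst P 1; rewrite unlock => ->.
    by rewrite cE -addrA EFinD.
  apply: expectation_le_of_dominated => w; rewrite (HE w).
  by apply: cond2_precond_bounds => // x; apply: hc (hQR _).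
Qed.
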